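(* Let $L_1=\{z\in\mathbb{H}:\operatorname{Re}z=-\tfrac12\}$, $L_2=\{z\in\mathbb{H}:|z|=1\}$, $L_3=\{z\in\mathbb{H}:\operatorname{Re}z=0\}$, and let $z_0\in\mathbb{H}$ with $-\tfrac12<\operatorname{Re}z_0<0$ and $|z_0|>1$. Let $s_1(z)=-1-\bar z$, $s_2(z)=1/\bar z$, $s_3(z)=-\bar z$ (the reflections in $L_1,L_2,L_3$), generating $W\cong PGL_2(\mathbb{Z})$, and let $(z_m)_{m\ge0}$ be the reduced random walk defined in the context. Then the limit $\zeta=\lim_{m\to\infty}z_m$ almost surely exists and is a real number, and its cumulative distribution function $F_\zeta(x)=\Pr[\zeta\le x]$ is, for all $x\in\mathbb{R}$, $$F_\zeta(x)=\begin{cases}\mathcal{I}(-1/x)& x\le-2,\\ \tfrac14-\tfrac12\mathcal{I}(-x-1)& -2\le x\le-1,\\ \tfrac14+\tfrac12\mathcal{I}(-1-1/x)+\tfrac12\mathcal{I}(x+1)& -1\le x\le-\tfrac12,\\ \tfrac12-\tfrac12\mathcal{I}(-x)& -\tfrac12\le x\le0,\\ \tfrac12+\mathcal{I}(x)& 0\le x\le1,\\ \tfrac78+\tfrac14\mathcal{I}(x-1)& 1\le x\le2,\\ 1-\tfrac12\mathcal{I}(1/x)& 2\le x.\end{cases}$$ In particular: (i) $F_\zeta$ is continuous and strictly increasing; (ii) $F_\zeta(x)$ is a dyadic rational for every $x\in\mathbb{Q}$; (iii) $F_\zeta(x)$ is rational for every quadratic irrational $x$.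
   Context: $\mathbb{H}=\{z\in\mathbb{C}:\operatorname{Im}z>0\}$, $\overline{\mathbb{R}}=\mathbb{R}\cup\{\infty\}$, $\overline{\mathbb{H}}=\mathbb{H}\cup\overline{\mathbb{R}}$. The one-way reflection $\tau_i\colon\overline{\mathbb{H}}\to\overline{\mathbb{H}}$ is $\tau_i(z)=s_i(z)$ if $z$ and $z_0$ are on the same side of $L_i$ and $\tau_i(z)=z$ otherwise. Let $i_1,i_2,\ldots$ be independent uniform random elements of $\{1,2,3\}$ and $z_m=(\tau_{i_1}\circ\cdots\circ\tau_{i_m})(z_0)$; equivalently $z_m=u_m(z_0)$ with $u_0=1$, $u_{m+1}=u_ms_{i_{m+1}}$ if $\ell(u_ms_{i_{m+1}})>\ell(u_m)$ and $u_{m+1}=u_m$ otherwise, $\ell$ being word length in $W$ with respect to $\{s_1,s_2,s_3\}$. For $x\in\mathbb{R}$ let $\{x\}=x-\lfloor x\rfloor$. The interrobang function $\mathcal{I}\colon[0,1]\cap\mathbb{Q}\to\mathbb{R}$ is defined recursively by $\mathcal{I}(0)=0$; $\mathcal{I}(x)=4^{-\lfloor1/x\rfloor}\big(1-2\,\mathcal{I}(\{1/x\})\big)$ if $0<x\le\tfrac12$; and $\mathcal{I}(x)=\tfrac38-\tfrac34\,\mathcal{I}(1/x-1)-\tfrac12\,\mathcal{I}(1-x)$ if $\tfrac12<x\le1$ (well founded by the height $a/b\mapsto|a|+|b|$). It is a fact (proved in the paper) that this function extends uniquely to a continuous strictly increasing function $\mathcal{I}\colon[0,1]\to\mathbb{R}$;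 $\mathcal{I}$ in the formula denotes this extension. A dyadic rational is a rational whose denominator in lowest terms is a power of $2$; a quadratic irrational is an irrational root of a nonzero rational quadratic polynomial. *)

(* Defs.v *)
From HB Require Import structures.
From mathcomp Require Import all_boot all_order all_algebra.
From mathcomp Require Import all_classical all_reals all_analysis.
Set Implicit Arguments. Unset Strict Implicit. Unset Printing Implicit Defensive.
Import Order.TTheory GRing.Theory Num.Theory.
Import numFieldNormedType.Exports.
Local Open Scope classical_set_scope.
Local Open Scope ring_scope.

(* Points of the upper half plane are represented as pairs (Re z, Im z). *)

(* s_1(z) = -1 - conj z,  s_2(z) = 1 / conj z = z / |z|^2,  s_3(z) = - conj z *)
Definition sq_norm {R : realType} (z : R * R) : R := z.1 ^+ 2 + z.2 ^+ 2.

Definition refl {R : realType} (i : 'I_3) (z : R * R) : R * R :=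
  match val i with
  | 0%N => (-1 - z.1, z.2)
  | 1%N => (z.1 / sq_norm z, z.2 / sq_norm z)
  | _ => (- z.1, z.2)
  end.

(* Signed "side" function of the geodesic L_i (zero exactly on L_i):
   L_1 : Re z = -1/2,  L_2 : |z| = 1,  L_3 : Re z = 0.  Index 0,1,2 of 'I_3
   stands for 1,2,3. *)
Definition side {R : realType} (i : 'I_3) (z : R * R) : R :=
  match val i with
  | 0%N => z.1 + 2^-1
  | 1%N => sq_norm z - 1
  | _ => z.1
  end.

Definition same_side {R : realType} (z0 : R * R) (i : 'I_3) (z : R * R) : bool :=
  0 < side i z * side i z0.

Definition tau {R : realType} (z0 : R * R) (i : 'I_3) (z : R * R) : R * R :=
  if same_side z0 i z then refl i z else z.

(* z_m = (tau_{i_1} o ... o tau_{i_m})(z0), where i_{k+1} = X k w. *)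
Definition walk {R : realType} {T : Type} (z0 : R * R) (X : nat -> T -> 'I_3)
    (m : nat) (w : T) : R * R :=
  foldr (fun i z => tau z0 i z) z0 [seq X k w | k <- iota 0 m].

Definition iid_uniform3 {R : realType} {d : measure_display}
    {T : measurableType d} (P : probability T R) (X : nat -> T -> 'I_3) : Prop :=
  (forall k (j : 'I_3), measurable [set w | X k w = j]) /\
  (forall k (j : 'I_3), P [set w | X k w = j] = (3^-1)%:E) /\
  (forall (s : seq nat) (a : nat -> 'I_3), uniq s ->
     P (\big[setI/setT]_(k <- s) [set w | X k w = a k]) =
     (\prod_(k <- s) fine (P [set w | X k w = a k]))%:E).

(* Specification of the interrobang function: the recursion on rationals of
   [0,1], plus continuity on [0,1] (which determines it uniquely on [0,1]). *)
Definition interrobang_spec {R : realType} (I : R -> R) : Prop :=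
  {within `[0, 1], continuous I} /\
  I 0 = 0 /\
  (forall q : rat, 0 < q <= 2^-1 ->
     I (ratr q) = 4 ^ (- Num.floor ((ratr q : R)^-1))
                  * (1 - 2 * I ((ratr q)^-1 - (Num.floor ((ratr q : R)^-1))%:~R))) /\
  (forall q : rat, 2^-1 < q <= 1 ->
     I (ratr q) = 3 / 8 - 3 / 4 * I ((ratr q : R)^-1 - 1) - 2^-1 * I (1 - ratr q)).

Definition cdf_of {R : realType} {d : measure_display} {T : measurableType d}
    (P : probability T R) (zeta : T -> R) (x : R) : R :=
  fine (P [set w | zeta w <= x]).

Definition is_rational {R : realType} (x : R) : Prop := exists q : rat, x = ratr q.

Definition is_dyadic {R : realType} (x : R) : Prop :=
  exists (k : int) (n : nat), x = k%:~R / 2 ^+ n.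

Definition quadratic_irrational {R : realType} (x : R) : Prop :=
  ~ is_rational x /\
  exists a b c : rat, a != 0 /\ ratr a * x ^+ 2 + ratr b * x + ratr c = 0.

Definition cdf_formula {R : realType} (I : R -> R) (F : R -> R) : Prop :=
  forall x : R,
  (x <= -2 -> F x = I (- x^-1)) /\
  (-2 <= x <= -1 -> F x = 4^-1 - 2^-1 * I (- x - 1)) /\
  (-1 <= x <= - 2^-1 -> F x = 4^-1 + 2^-1 * I (-1 - x^-1) + 2^-1 * I (x + 1)) /\
  (- 2^-1 <= x <= 0 -> F x = 2^-1 - 2^-1 * I (- x)) /\
  (0 <= x <= 1 -> F x = 2^-1 + I x) /\
  (1 <= x <= 2 -> F x = 7 / 8 + 4^-1 * I (x - 1)) /\
  (2 <= x -> F x = 1 - 2^-1 * I (x^-1)).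

(* Main.v *)
(** The folding maps tau_i, extended to the real line, do not increase Euclidean
    distances, and the composite tau_2 tau_1 tau_3 tau_1 divides them by at least
    9/4.  This word occurs infinitely often in almost every sequence of letters,
    so z_m converges to a real point zeta, which is also the limit of the folded
    origin.  Splitting off the first letter shows that the law of zeta is
    stationary under a uniformly chosen fold.

    For atoms, stationarity improves any uniform bound c on P(zeta = x) to 7c/8;
    hence there are none.  For half-lines it gives five linear functional
    equations for the distribution function F; eliminating among them,
    I = F - 1/2 on [0, 1] satisfies the recursion of the interrobang function,
    which with continuity determines I.  Strict monotonicity holds because every
    rational is the image of 0 under some word, and 0 is approached by the images
    of tau_2 (tau_1 tau_3)^n.

    On rationals the recursion terminates in dyadic numbers.  At a quadratic
    irrational x the orbit under the Gauss map x |-> {1/x} is eventually periodic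
    (Lagrange), and along it I obeys an affine two-step recursion with rational
    coefficients whose linear part is contracting, so its values solve a
    nonsingular rational linear system. *)
Require Import Defs.
From HB Require Import structures.
From mathcomp Require Import all_boot all_order all_algebra.
From mathcomp Require Import all_classical all_reals all_analysis.
From mathcomp Require Import measurable_realfun ring lra zify.
Set Implicit Arguments. Unset Strict Implicit. Unset Printing Implicit Defensive.
Import Order.TTheory GRing.Theory Num.Theory.
Import numFieldNormedType.Exports.
Local Open Scope classical_set_scope.
Local Open Scope ring_scope.

(** * The functional equations of the distribution function *)

(** Each clause is the stationarity [3 F(x) = sum_i P(tau_i(zeta) <= x)] on a range of [x] where the
    three events are explicit, with the terms in [F x] collected. The ranges are cut where the
    images []-oo, -1/2]], [[-1, 1]] and [[0, +oo[] of the folds end. *)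
Record fold_equations (R : realType) (F : R -> R) : Prop := FoldEquations {
  fold_eq0 : F 0 = 2^-1;
  fold_le_N1 : forall x, x <= -1 -> 2 * F x = 1 - F (-1 - x);
  fold_N1_Nhalf : forall x, -1 <= x <= - 2^-1 ->
    F x = 1 - F (-1 - x) - F x^-1;
  fold_Nhalf_0 : forall x, - 2^-1 <= x < 0 -> 2 * F x = 1 - F x^-1;
  fold_0_1 : forall x, 0 < x <= 1 -> F x = 2 - F x^-1 - F (- x);
  fold_ge_1 : forall x, 1 <= x -> 2 * F x = 2 - F (- x) }.

Section FoldEquations.
Variables (R : realType) (F : R -> R).
Hypothesis HF : fold_equations F.

Let J (x : R) : R := F x - 2^-1.

(** This is the source of the power of [4] in the recursion: passing from [-y] to [y - 1] and from
    there to [1 - y] costs a factor [1/2] each time. *)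
Lemma fold_shift y : 2 <= y -> F (- y) = F (- (y - 1)) / 4.
Proof.
move=> y2.
have := fold_le_N1 HF (x := - y) ltac:(lra).
have -> : -1 - - y = y - 1 by ring.
have := fold_ge_1 HF (x := y - 1) ltac:(lra).
lra.
Qed.

Lemma fold_N2_N1 y : 1 <= y <= 2 -> F (- y) = 4^-1 - 2^-1 * J (y - 1).
Proof.
move=> y12.
have := fold_le_N1 HF (x := - y) ltac:(lra).
have -> : -1 - - y = y - 1 by ring.
rewrite /J; lra.
Qed.

Lemma fold_neg (n : nat) (y : R) : n.+1%:R <= y <= n.+2%:R ->
  F (- y) = 4^-1 ^+ n.+1 * (1 - 2 * J (y - n.+1%:R)).
Proof.
elim: n y => [|n IH] y Hy.
  by rewrite fold_N2_N1 // expr1; lra.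
have n0 : 0 <= n%:R :> R by rewrite ler0n.
have e1 : n.+1%:R = n%:R + 1 :> R by rewrite -natr1.
have e2 : n.+2%:R = n%:R + 2 :> R by rewrite -natr1 e1; ring.
have e3 : n.+3%:R = n%:R + 3 :> R by rewrite -natr1 e2; ring.
move: Hy; rewrite e2 e3 => Hy.
rewrite fold_shift; last by lra.
rewrite IH; last by rewrite e1 e2; lra.
have -> : y - 1 - n.+1%:R = y - n.+2%:R by rewrite e1 e2; ring.
by rewrite -e2 [in RHS]exprS; ring.
Qed.

(** The values at [1/x] and at [-x] both reduce to [F(-1/x)] with weight one half; eliminating them
    from the equation at [x] leaves [F(-1/x)] alone. *)
Lemma fold_invN x : 0 < x <= 2^-1 -> J x = F (- x^-1).
Proof.
move=> x0.
have xi : 2 <= x^-1 by rewrite -[2]invrK lef_pV2 ?posrE; lra.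
have := fold_0_1 HF (x := x) ltac:(lra).
have := fold_Nhalf_0 HF (x := - x) ltac:(lra).
have := fold_ge_1 HF (x := x^-1) ltac:(lra).
rewrite invrN /J; lra.
Qed.

Lemma fold_opp x : 0 <= x <= 2^-1 -> F (- x) = 2^-1 - 2^-1 * J x.
Proof.
have [->|x0 xh] := eqVneq x 0; first by rewrite oppr0 /J (fold_eq0 HF); lra.
have x1 : 0 < x by rewrite lt_neqAle eq_sym x0; lra.
rewrite fold_invN; last by lra.
have := fold_Nhalf_0 HF (x := - x) ltac:(lra).
rewrite invrN; lra.
Qed.

Lemma fold_1_2 x : 1 <= x <= 2 -> F x = 7 / 8 + 4^-1 * J (x - 1).
Proof.
move=> x12.
have := fold_ge_1 HF (x := x) ltac:(lra).
rewrite fold_N2_N1; lra.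
Qed.

Lemma floor_inv_ge2 (x : R) : 0 < x <= 2^-1 ->
  exists2 n : nat, Num.floor x^-1 = n.+2%:Z & n.+2%:R <= x^-1 < n.+3%:R.
Proof.
move=> x0; have xi : 2 <= x^-1 by rewrite -[2]invrK lef_pV2 ?posrE; lra.
have f2 : (2 <= Num.floor x^-1)%R by rewrite floor_ge_int.
case E: (Num.floor x^-1) f2 => [[|[|n]]|n] // _.
exists n => //; have := floor_itv x^-1.
by rewrite E intrD -pmulrn natr1.
Qed.

Lemma fold_gauss_low (x : R) : 0 < x <= 2^-1 ->
  J x = 4 ^ (- Num.floor x^-1) * (1 - 2 * J (x^-1 - (Num.floor x^-1)%:~R)).
Proof.
move=> x0; have [n -> nx] := floor_inv_ge2 x0.
rewrite fold_invN // (@fold_neg n.+1); last by lra.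
by rewrite -pmulrn -invr_expz exprVn.
Qed.

(** After elimination of [F(-x)], both [F(1/x)] and [F(-1/x)] remain. They contribute [1/4] and
    [1/2] of [J(1/x - 1)], which add up to the coefficient [3/4]. *)
Lemma fold_gauss_high (x : R) : 2^-1 <= x <= 1 ->
  J x = 3 / 8 - 3 / 4 * J (x^-1 - 1) - 2^-1 * J (1 - x).
Proof.
move=> x0; have x1 : 0 < x by lra.
have xi : 1 <= x^-1 <= 2.
  by rewrite -[2]invrK -{1}[1]invr1 !lef_pV2 ?posrE; lra.
have := fold_0_1 HF (x := x) ltac:(lra).
have := fold_N1_Nhalf HF (x := - x) ltac:(lra).
have -> : -1 - - x = - (1 - x) by ring.
rewrite invrN (@fold_opp (1 - x)); last by lra.
rewrite (@fold_N2_N1 x^-1) // (fold_1_2 xi).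
rewrite /J; lra.
Qed.

Lemma fold_J0 : J 0 = 0. Proof. by rewrite /J (fold_eq0 HF) subrr. Qed.

Lemma interrobang_fold : continuous F -> interrobang_spec J.
Proof.
move=> cF; split; [|split; [|split]].
- apply: continuous_subspaceT => x.
  by apply: cvgB; [exact: cF|exact: cvg_cst].
- exact: fold_J0.
- move=> q q0; apply: fold_gauss_low.
  have -> : 2^-1 = ratr 2^-1 :> R by rewrite [RHS]fmorphV /= ratr_nat.
  by rewrite ltr0q ler_rat.
- move=> q q0; apply: fold_gauss_high.
  have -> : 2^-1 = ratr 2^-1 :> R by rewrite [RHS]fmorphV /= ratr_nat.
  have -> : 1 = ratr 1 :> R by rewrite [RHS]rmorph1.
  by rewrite !ler_rat; case/andP: q0 => /ltW -> ->.
Qed.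

Lemma cdf_formula_fold : cdf_formula J F.
Proof.
move=> x; split=> [x2|].
  rewrite -invrN fold_invN; first by rewrite invrK opprK.
  rewrite invr_gt0 lef_pV2 ?posrE; lra.
split=> [x2|]; first by rewrite -{1}[x]opprK fold_N2_N1 //; lra.
split=> [x2|].
  rewrite (fold_N1_Nhalf HF) //.
  have -> : -1 - x = - (x + 1) by ring.
  rewrite fold_opp; last by lra.
  have xi : 1 <= (- x)^-1 <= 2.
    by rewrite -[2]invrK -{1}[1]invr1 !lef_pV2 ?posrE; lra.
  have -> : x^-1 = - (- x)^-1 by rewrite invrN opprK.
  rewrite fold_N2_N1 //.
  have -> : -1 - - (- x)^-1 = (- x)^-1 - 1 by ring.
  lra.
split=> [x2|]; first by rewrite -{1}[x]opprK fold_opp //; lra.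
split=> [x2|]; first by rewrite /J; lra.
split=> [x2|x2]; first by rewrite fold_1_2.
have := fold_ge_1 HF (x := x) ltac:(lra).
rewrite fold_invN ?invrK; first by lra.
by rewrite invr_gt0 lef_pV2 ?posrE; lra.
Qed.
End FoldEquations.

(** The recursion of the interrobang function terminates because numerator plus denominator
    decreases: [a/b] leads to [(b mod a)/a] below one half, and to [(b - a)/a] and [(b - a)/b]
    above. *)
Lemma rat01_ind (P : rat -> Prop) :
  P 0 ->
  (forall q, 0 < q <= 2^-1 -> P (q^-1 - (Num.floor q^-1)%:~R) -> P q) ->
  (forall q, 2^-1 < q <= 1 -> P (q^-1 - 1) -> P (1 - q) -> P q) ->
  forall q, 0 <= q <= 1 -> P q.
Proof.
move=> P0 Plow Phigh q q01.
(* Fractions need not be in lowest terms here, so the new fractions never have to be reduced. *)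
suff main : forall N a b : nat, (0 < b)%N -> (a <= b)%N -> (a + b <= N)%N ->
    P (a%:R / b%:R).
  have nq : (0 <= numq q)%R by rewrite numq_ge0; lra.
  have dq : (0 < denq q)%R by exact: denq_gt0.
  have eq_q : q = `|numq q|%N%:R / `|denq q|%N%:R.
    rewrite -{1}[q]divq_num_den -{1}(gez0_abs nq).
    by rewrite -{1}(gez0_abs (ltW dq)) -!pmulrn.
  rewrite eq_q; apply: (main _ _ _ _ _ (leqnn _)).
    by rewrite absz_gt0 gt_eqF.
  have d0 : 0 < `|denq q|%N%:R :> rat by rewrite ltr0n absz_gt0 gt_eqF.
  have : q <= 1 by lra.
  by rewrite {1}eq_q ler_pdivrMr // mul1r ler_nat.
elim=> [|N IH] a b b0 ab abN; first by lia.
have [->|a0] := posnP a; first by rewrite mul0r.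
have b0' : 0 < b%:R :> rat by rewrite ltr0n.
have a0' : 0 < a%:R :> rat by rewrite ltr0n.
have ab' : a%:R <= b%:R :> rat by rewrite ler_nat.
have [le|gt] := leP (a%:R / b%:R) (2^-1 : rat).
  apply: Plow; first by rewrite divr_gt0.
  have -> : (a%:R / b%:R : rat)^-1 - (Num.floor (a%:R / b%:R : rat)^-1)%:~R
     = (b %% a)%N%:R / a%:R.
    have eqb : (a%:R / b%:R : rat)^-1 = (b %/ a)%N%:R + (b %% a)%N%:R / a%:R.
      rewrite invf_div {1}(divn_eq b a) natrD natrM mulrDl mulfK //.
      exact: lt0r_neq0.
    rewrite eqb; have -> : Num.floor ((b %/ a)%N%:R + (b %% a)%N%:R / a%:R : rat)
       = (b %/ a)%N%:Z.
      apply/floor_def; rewrite -pmulrn lerDl divr_ge0 //=.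
      rewrite intrD -pmulrn ltrD2l ltr_pdivrMr // mul1r ltr_nat ltn_pmod //.
    by rewrite -pmulrn addrC addKr.
  apply: IH => //; first by apply: ltnW; rewrite ltn_pmod.
  by have := ltn_pmod b a0; lia.
(* This is what makes [(b - a) + b] smaller than [a + b]. *)
have lt_b2a : (b < 2 * a)%N.
  by rewrite -(ltr_nat rat) natrM; move: gt; rewrite ltr_pdivlMr //; lra.
apply: Phigh.
- by rewrite gt ler_pdivrMr // mul1r.
- have -> : (a%:R / b%:R : rat)^-1 - 1 = (b - a)%N%:R / a%:R.
    by rewrite natrB //; field; rewrite !lt0r_neq0.
  by apply: IH => //; lia.
- have -> : 1 - (a%:R / b%:R : rat) = (b - a)%N%:R / b%:R.
    by rewrite natrB //; field; rewrite !lt0r_neq0.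
  by apply: IH => //; lia.
Qed.

Lemma ratr01 (R : realType) (q : rat) :
  (0 <= (ratr q : R) <= 1) = (0 <= q <= 1).
Proof. by rewrite ler0q -(ler_rat R) [ratr 1]rmorph1. Qed.

Lemma floor_ratr (R : realType) (q : rat) : Num.floor (ratr q : R) = Num.floor q.
Proof.
have e (k : int) : k%:~R = ratr k%:~R :> R by rewrite ratr_int.
by apply/floor_def; rewrite !e ler_rat ltr_rat; exact: floor_itv.
Qed.

(** * Uniqueness of the interrobang function and its dyadic values *)

Section InterrobangUniqueness.
Variables (R : realType).

Lemma interrobang_rat_ind (P : R -> Prop) (I : R -> R) : interrobang_spec I ->
  P 0 ->
  (forall (n : nat) x, P x -> P (4 ^- n * (1 - 2 * x))) ->
  (forall x y, P x -> P y -> P (3 / 8 - 3 / 4 * x - 2^-1 * y)) ->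
  forall q : rat, 0 <= q <= 1 -> P (I (ratr q)).
Proof.
move=> [_ [I0 [Il Ih]]] P0 Pl Ph; apply: rat01_ind => [|q q0 Pq|q q0 Pq Pq'].
- by rewrite rmorph0 I0.
- rewrite Il //.
  have q2 : 0 < (ratr q : R) <= 2^-1.
    have -> : 2^-1 = ratr 2^-1 :> R by rewrite [RHS]fmorphV /= ratr_nat.
    by rewrite ltr0q ler_rat.
  have [n eqn _] := floor_inv_ge2 q2.
  rewrite eqn -invr_expz; apply: Pl.
  by move: Pq; rewrite rmorphB /= ratr_int -(floor_ratr R) fmorphV eqn.
- rewrite Ih //; apply: Ph.
    by move: Pq; rewrite rmorphB fmorphV /= rmorph1.
  by move: Pq'; rewrite rmorphB /= rmorph1.
Qed.

Lemma interrobang_unique_rat (I1 I2 : R -> R) :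
  interrobang_spec I1 -> interrobang_spec I2 ->
  forall q : rat, 0 <= q <= 1 -> I1 (ratr q) = I2 (ratr q).
Proof.
move=> [_ [I0 [Il Ih]]] [_ [I0' [Il' Ih']]].
apply: rat01_ind => [|q q0 Pq|q q0 Pq Pq'].
- by rewrite rmorph0 I0.
- rewrite Il // Il' //; congr (_ * (1 - 2 * _)).
  by move: Pq; rewrite rmorphB /= ratr_int -(floor_ratr R) fmorphV.
- rewrite Ih // Ih' //; congr (_ - _ * _ - _ * _).
    by move: Pq; rewrite rmorphB fmorphV /= rmorph1.
  by move: Pq'; rewrite rmorphB /= rmorph1.
Qed.

Lemma eq_within_rat01 (f g : R -> R) :
  {within `[0, 1], continuous f} -> {within `[0, 1], continuous g} ->
  (forall q : rat, 0 <= q <= 1 -> f (ratr q) = g (ratr q)) ->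
  forall x, 0 <= x <= 1 -> f x = g x.
Proof.
move=> cf cg fg x x01.
have xin : `[0, 1]%classic x by rewrite /= in_itv.
apply/eqP; rewrite -subr_eq0 -normr_eq0; apply/eqP/le_anti.
rewrite normr_ge0 andbT; apply/ler_addgt0Pr => e e0; rewrite add0r.
have e2 : 0 < e / 2 by lra.
have near_f (h : R -> R) : {within `[0, 1], continuous h} ->
    exists2 d : R, 0 < d & forall y, 0 <= y <= 1 -> `|x - y| < d ->
      `|h x - h y| < e / 2.
  move=> /subspace_continuousP /(_ x xin) /cvgrPdist_lt /(_ _ e2).
  rewrite near_withinE => -[d /= d0 Hd].
  by exists d => // y y01 xy; apply: (Hd y) => //=; rewrite in_itv.
have [d1 d10 Hf] := near_f f cf.
have [d2 d20 Hg] := near_f g cg.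
pose d := Num.min d1 d2.
have d0 : 0 < d by rewrite lt_min d10.
(* Truncating at [0] and [1] keeps the rational in the domain of continuity even when [x] is an
   endpoint. *)
have [q qlt] : exists q : rat, Num.max 0 (x - d) < ratr q < Num.min 1 (x + d).
  have lt : Num.max 0 (x - d) < Num.min 1 (x + d).
    rewrite gt_max !lt_min; lra.
  by have [q] := rat_in_itvoo lt; rewrite in_itv /=; exists q.
move: qlt; rewrite gt_max lt_min => /andP[/andP[q0 qx] /andP[q1 qx']].
have q01 : 0 <= q <= 1 by rewrite -(ratr01 R); lra.
have xq : `|x - ratr q| < d by rewrite ltr_norml; lra.
have Hf' := Hf (ratr q) ltac:(lra) ltac:(by move: xq; rewrite lt_min => /andP[]).
have Hg' := Hg (ratr q) ltac:(lra) ltac:(by move: xq; rewrite lt_min => /andP[]).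
move: Hf' Hg'; rewrite -fg // => Hf' Hg'.
rewrite -(subrKA (f (ratr q))) (le_trans (ler_normD _ _)) //.
by rewrite [`|f (ratr q) - _|]distrC; lra.
Qed.

Lemma interrobang_unique (I1 I2 : R -> R) :
  interrobang_spec I1 -> interrobang_spec I2 ->
  forall x, 0 <= x <= 1 -> I1 x = I2 x.
Proof.
move=> H1 H2; apply: eq_within_rat01; [exact: H1.1|exact: H2.1|].
exact: interrobang_unique_rat.
Qed.

Lemma cdf_formula_eq (I1 I2 F : R -> R) :
  (forall x, 0 <= x <= 1 -> I1 x = I2 x) -> cdf_formula I1 F -> cdf_formula I2 F.
Proof.
move=> I12 H x.
have [H1 [H2 [H3 [H4 [H5 [H6 H7]]]]]] := H x.
split=> [xx|].
  rewrite -I12 ?H1 // -invrN invr_ge0 invf_le1; lra.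
split=> [xx|]; first by rewrite -I12 ?H2 //; lra.
split=> [xx|].
  have xi : 1 <= (- x)^-1 <= 2.
    by rewrite -[2]invrK -{1}[1]invr1 !lef_pV2 ?posrE; lra.
  have e : x^-1 = - (- x)^-1 by rewrite invrN opprK.
  by rewrite -!I12 ?H3 //; rewrite ?e; lra.
split=> [xx|]; first by rewrite -I12 ?H4 //; lra.
split=> [xx|]; first by rewrite -I12 ?H5 //; lra.
split=> [xx|xx]; first by rewrite -I12 ?H6 //; lra.
by rewrite -I12 ?H7 // invr_ge0 invf_le1; lra.
Qed.

Lemma is_dyadicD (x y : R) : is_dyadic x -> is_dyadic y -> is_dyadic (x + y).
Proof.
move=> [k [n ->]] [l [m ->]]; exists (k * 2 ^+ m + l * 2 ^+ n), (n + m)%N.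
rewrite intrD !intrM !rmorphXn /= exprD.
by field; rewrite !expf_neq0.
Qed.

Lemma is_dyadicM (x y : R) : is_dyadic x -> is_dyadic y -> is_dyadic (x * y).
Proof.
move=> [k [n ->]] [l [m ->]]; exists (k * l), (n + m)%N.
by rewrite intrM exprD invfM mulrACA.
Qed.

Lemma is_dyadic_int (k : int) : is_dyadic (k%:~R : R).
Proof. by exists k, 0%N; rewrite expr0 divr1. Qed.

Lemma is_dyadicN (x : R) : is_dyadic x -> is_dyadic (- x).
Proof. by move=> [k [n ->]]; exists (- k), n; rewrite rmorphN mulNr. Qed.

Lemma is_dyadic_half : is_dyadic (2^-1 : R).
Proof. by exists 1, 1%N; rewrite mul1r expr1. Qed.

Lemma is_dyadicVX (n : nat) : is_dyadic (4 ^- n : R).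
Proof.
exists 1, (2 * n)%N; rewrite mul1r exprM; congr (_ ^- _).
by rewrite expr2; ring.
Qed.

Lemma interrobang_dyadic (I : R -> R) : interrobang_spec I ->
  forall q : rat, 0 <= q <= 1 -> is_dyadic (I (ratr q)).
Proof.
have d1 : is_dyadic (1 : R) by exact: (is_dyadic_int 1).
have d2 : is_dyadic (2 : R) by exact: (is_dyadic_int 2).
have d3 : is_dyadic (3 : R) by exact: (is_dyadic_int 3).
have h := is_dyadic_half.
move=> HI; apply: (interrobang_rat_ind HI) => [|n x dx|x y dx dy].
- exact: (is_dyadic_int 0).
- apply: is_dyadicM; first exact: is_dyadicVX.
  by apply: is_dyadicD => //; apply/is_dyadicN/is_dyadicM.
- have -> : 3 / 8 - 3 / 4 * x - 2^-1 * y =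
      3 * (2^-1 * (2^-1 * 2^-1)) - 3 * (2^-1 * 2^-1) * x - 2^-1 * y by field.
  have dh2 : is_dyadic (2^-1 * 2^-1 : R) by exact: is_dyadicM.
  apply: is_dyadicD; last by apply/is_dyadicN/is_dyadicM.
  apply: is_dyadicD; first by apply: is_dyadicM => //; apply: is_dyadicM.
  by apply: is_dyadicN; apply: is_dyadicM => //; apply: is_dyadicM.
Qed.

(** All seven branches evaluate [I] at points obtained from [x] by negation, unit shifts and
    inversion, and combine the values with dyadic constants. One case analysis thus serves both for
    rationals with dyadic values and for quadratic irrationals with rational values. *)
Lemma cdf_formula_closed (D S : R -> Prop) (I F : R -> R) : cdf_formula I F ->
  (forall x, D x -> D (- x)) -> (forall x, D x -> D (x + 1)) ->
  (forall x, D x -> D x^-1) ->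
  S 1 -> S 2^-1 -> (forall x y, S x -> S y -> S (x + y)) ->
  (forall x, S x -> S (- x)) -> (forall x y, S x -> S y -> S (x * y)) ->
  (forall x, D x -> 0 <= x <= 1 -> S (I x)) -> forall x, D x -> S (F x).
Proof.
move=> HF DN D1 DV S1 Sh SD SN SM SI x Dx.
have DB1 y : D y -> D (y - 1).
  by move=> Dy; rewrite -opprB addrC; apply: (DN); apply: (D1); apply: (DN).
have S4 : S 4^-1.
  have -> : 4^-1 = 2^-1 * 2^-1 :> R by field.
  exact: SM.
have S78 : S (7 / 8).
  have -> : 7 / 8 = 1 - 2^-1 * 4^-1 :> R by field.
  by apply: (SD) => //; apply: (SN); apply: (SM).
have SB y z : S y -> S z -> S (y - z) by move=> Sy Sz; apply: (SD) => //; exact: SN.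
have [H1 [H2 [H3 [H4 [H5 [H6 H7]]]]]] := HF x.
have [x1|x1] := leP x (-2).
  rewrite H1 //; apply: (SI); first by apply: (DN); exact: DV.
  rewrite -invrN invr_ge0 invf_le1; lra.
have [x2|x2] := leP x (-1).
  rewrite H2; last by lra.
  by apply: (SB) => //; apply: (SM) => //; apply: (SI); [apply: (DB1); exact: DN|lra].
have [x3|x3] := leP x (- 2^-1).
  rewrite H3; last by lra.
  have xi : 1 <= (- x)^-1 <= 2.
    by rewrite -[2]invrK -{1}[1]invr1 !lef_pV2 ?posrE; lra.
  have e : -1 - x^-1 = (- x)^-1 - 1 by rewrite invrN addrC.
  rewrite e; apply: (SD); [apply: (SD) => //|]; apply: (SM) => //; apply: (SI).
  - by apply: (DB1); apply: (DV); exact: DN.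
  - by lra.
  - exact: D1.
  - by lra.
have [x4|x4] := leP x 0.
  rewrite H4; last by lra.
  by apply: (SB) => //; apply: (SM) => //; apply: (SI); [exact: DN|lra].
have [x5|x5] := leP x 1.
  by rewrite H5; [apply: (SD) => //; apply: (SI) => //|]; lra.
have [x6|x6] := leP x 2.
  rewrite H6; last by lra.
  by apply: (SD) => //; apply: (SM) => //; apply: (SI); [exact: DB1|lra].
rewrite H7; last by lra.
apply: (SB) => //; apply: (SM) => //; apply: (SI); first exact: DV.
by rewrite invr_ge0 invf_le1; lra.
Qed.

Lemma cdf_formula_dyadic (I F : R -> R) : interrobang_spec I ->
  cdf_formula I F -> forall q : rat, is_dyadic (F (ratr q)).
Proof.
move=> HI HF q.
apply: (cdf_formula_closed (D := is_rational) (S := is_dyadic) HF); last by exists q.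
- by move=> x [r ->]; exists (- r); rewrite rmorphN.
- by move=> x [r ->]; exists (r + 1); rewrite rmorphD rmorph1.
- by move=> x [r ->]; exists r^-1; rewrite fmorphV.
- exact: (is_dyadic_int 1).
- exact: is_dyadic_half.
- exact: is_dyadicD.
- exact: is_dyadicN.
- exact: is_dyadicM.
- by move=> x [r ->]; rewrite ratr01 => ?; exact: interrobang_dyadic.
Qed.
End InterrobangUniqueness.

(** * Gauss map and quadratic irrationals *)

Section QuadraticIrrationals.
Variable R : realType.
Implicit Types x y : R.

Definition gauss x : R := x^-1 - (Num.floor x^-1)%:~R.

Lemma is_rationalD x y : is_rational x -> is_rational y -> is_rational (x + y).
Proof. by move=> [p ->] [q ->]; exists (p + q); rewrite rmorphD. Qed.

Lemma is_rationalM x y : is_rational x -> is_rational y -> is_rational (x * y).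
Proof. by move=> [p ->] [q ->]; exists (p * q); rewrite rmorphM. Qed.

Lemma is_rationalN x : is_rational x -> is_rational (- x).
Proof. by move=> [p ->]; exists (- p); rewrite rmorphN. Qed.

Lemma is_rationalV x : is_rational x -> is_rational x^-1.
Proof. by move=> [p ->]; exists p^-1; rewrite fmorphV. Qed.

Lemma is_rational_int (k : int) : is_rational (k%:~R : R).
Proof. by exists k%:~R; rewrite ratr_int. Qed.

Lemma is_rational_ratr (q : rat) : is_rational (ratr q : R).
Proof. by exists q. Qed.

Lemma gauss_irrational x : ~ is_rational x -> ~ is_rational (gauss x).
Proof.
move=> irr rat_g; apply: irr; rewrite -[x]invrK; apply: is_rationalV.
rewrite -[x^-1](subrK (Num.floor x^-1)%:~R).
by apply: is_rationalD => //; exact: is_rational_int.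
Qed.

Lemma gauss_itv x : ~ is_rational x -> 0 < gauss x < 1.
Proof.
move=> /gauss_irrational irr.
have := floor_itv x^-1; rewrite intrD => /andP[le lt].
have g0 : 0 != gauss x.
  by apply/eqP => e; apply: irr; rewrite -e; exact: (is_rational_int 0).
have g0' : 0 <= gauss x by rewrite subr_ge0.
by rewrite lt_neqAle g0 g0' /= /gauss; lra.
Qed.

Lemma iter_gauss_irrational k x : ~ is_rational x -> ~ is_rational (iter k gauss x).
Proof. by move=> irr; elim: k => //= k; exact: gauss_irrational. Qed.

Lemma iter_gauss_itv k x : ~ is_rational x -> 0 < x < 1 -> 0 < iter k gauss x < 1.
Proof. by case: k => //= k irr _; apply/gauss_itv/iter_gauss_irrational. Qed.

Lemma floor_inv_ge1 x : 0 < x < 1 ->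
  exists2 n : nat, Num.floor x^-1 = n.+1%:Z & n.+1%:R <= x^-1 < n.+2%:R.
Proof.
move=> x01; have x1 : 1 < x^-1 by rewrite invf_gt1; lra.
have f1 : (1 <= Num.floor x^-1)%R by rewrite floor_ge_int; lra.
case E: (Num.floor x^-1) f1 => [[|n]|n] // _.
exists n => //; have := floor_itv x^-1.
by rewrite E intrD -pmulrn natr1.
Qed.

Definition root_of (a b c : int) x : Prop :=
  a%:~R * x ^+ 2 + b%:~R * x + c%:~R = 0.

Lemma root_of_neq0 a b c x : ~ is_rational x -> root_of a b c x -> a != 0 -> c != 0.
Proof.
move=> irr rx a0; apply/eqP => c0; apply: irr.
move: rx; rewrite /root_of c0 addr0 expr2 mulrA -mulrDl => /eqP.
rewrite mulf_eq0 => /orP[|/eqP ->]; last exact: (is_rational_int 0).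
rewrite addr_eq0 => /eqP e.
have -> : x = (- b)%:~R / a%:~R.
  by rewrite rmorphN -e mulrAC mulfV ?mul1r // intr_eq0.
by apply: is_rationalM; [|apply: is_rationalV]; exact: is_rational_int.
Qed.

(* The new form has the same discriminant as the old one. *)
Lemma root_of_gauss a b c x n : x != 0 -> Num.floor x^-1 = n ->
  root_of a b c x ->
  root_of c (2 * c * n + b) (c * n ^+ 2 + b * n + a) (gauss x).
Proof.
rewrite /root_of /gauss => x0 -> rx.
have -> : c%:~R * (x^-1 - n%:~R) ^+ 2 + (2 * c * n + b)%:~R * (x^-1 - n%:~R) +
   (c * n ^+ 2 + b * n + a)%:~R =
   (a%:~R * x ^+ 2 + b%:~R * x + c%:~R) / x ^+ 2.
  by rewrite !rmorphD !rmorphM /=; field.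
by rewrite rx mul0r.
Qed.

(** With [y = gauss x], the number [1/x = n + y] is a root of [c t^2 + b t + a], so the value of
    this form at [n] factors as [-y (c n - a x)]. The claim becomes [a c x < c^2 n], which either
    alternative gives because [x < 1 <= n]. *)
Lemma gauss_form_sign a b c x n : 0 < x < 1 -> ~ is_rational x ->
  Num.floor x^-1 = n -> root_of a b c x -> a != 0 ->
  (a * c < 0) \/ (`|a| <= `|c|) ->
  c * (c * n ^+ 2 + b * n + a) < 0.
Proof.
move=> x01 irr fx rx a0 ac; have := gauss_itv irr; rewrite /gauss fx.
have x1 : 1 < x^-1 by rewrite invf_gt1; lra.
have [m fm mx] := floor_inv_ge1 x01; move: fx; rewrite fm => <-{n}.
have c0 := root_of_neq0 irr rx a0.
set y := x^-1 - _ => /andP[y0 y1].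
rewrite -oppr_gt0 -(ltr0z R).
pose A : R := a%:~R; pose B : R := b%:~R; pose C : R := c%:~R.
pose N : R := m.+1%:R.
have -> : (- (c * (c * m.+1%:Z ^+ 2 + b * m.+1%:Z + a)))%:~R =
    y * (C ^+ 2 * N - A * C * x).
  rewrite rmorphN !(rmorphM, rmorphD) /= -!pmulrn -/A -/B -/C -/N.
  have -> : B = - (A * x + C / x).
    move: rx; rewrite /root_of -/A -/B -/C => rx.
    apply: (@mulIf _ x); first by rewrite lt0r_neq0; lra.
    rewrite mulNr mulrDl divfK; last by rewrite lt0r_neq0; lra.
    by rewrite -mulrA -expr2; lra.
  rewrite /y -pmulrn -/N; field; rewrite lt0r_neq0; lra.
apply: mulr_gt0 => //.
have N1 : 1 <= N by rewrite /N ler1n.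
have C2 : 0 < C ^+ 2 by rewrite exprn_even_gt0 //= intr_eq0.
have C2N : C ^+ 2 <= C ^+ 2 * N by rewrite ler_peMr // ltW.
rewrite subr_gt0; case: ac => ac.
  apply: lt_le_trans C2N; apply: lt_trans C2.
  by rewrite nmulr_rlt0 ?(andP x01).1 // -rmorphM /= ltrz0.
apply: lt_le_trans C2N.
apply: (@le_lt_trans _ _ (`|A * C| * x)).
  by rewrite ler_wpM2r ?ler_norm //; lra.
apply: (@lt_le_trans _ _ `|A * C|).
  rewrite gtr_pMr ?normr_gt0; first by lra.
  by rewrite mulf_neq0 // intr_eq0.
rewrite normrM -(real_normK (num_real C)) expr2 ler_wpM2r //.
by rewrite -!intr_norm ler_int.
Qed.

(** Outer coefficients of opposite sign mean that the conjugate root is negative, which is weaker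
    than classical reducedness (conjugate below [-1]) but enough for finiteness at fixed
    discriminant [D]. *)
Definition reduced (D : int) x : Prop :=
  [/\ ~ is_rational x, 0 < x < 1 & exists a b c : int,
    [/\ root_of a b c x, a * c < 0 & b ^+ 2 - 4 * a * c = D]].

Lemma reduced_gauss D x : reduced D x -> reduced D (gauss x).
Proof.
move=> [irr x01 [a [b [c [rx ac <-]]]]]; split.
- exact: gauss_irrational.
- exact: gauss_itv.
- set n := Num.floor x^-1.
  exists c, (2 * c * n + b), (c * n ^+ 2 + b * n + a); split.
  + by apply: root_of_gauss => //; rewrite lt0r_neq0; lra.
  + apply: (gauss_form_sign (x := x)) => //; last by left.
    by apply: contraTneq ac => ->; rewrite mul0r.
  + by ring.
Qed.

(** Descent on the leading coefficient: if [|a| <= |c|], one Gauss step already gives a reduced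
    form; otherwise the next form has the smaller leading coefficient [c]. *)
Lemma reach_reduced a b c x : ~ is_rational x -> 0 < x < 1 -> a != 0 ->
  root_of a b c x -> exists k D, reduced D (iter k gauss x).
Proof.
move: {2}`|a|%N (leqnn `|a|%N) => N.
elim: N a b c x => [|N IH] a b c x aN irr x01 a0 rx.
  by move: aN a0; rewrite leqn0 absz_eq0 => ->.
have [ac|ac] := ltP (a * c) 0.
  by exists 0%N, (b ^+ 2 - 4 * a * c); split => //; exists a, b, c.
set n := Num.floor x^-1.
have rg : root_of c (2 * c * n + b) (c * n ^+ 2 + b * n + a) (gauss x).
  by apply: root_of_gauss => //; rewrite lt0r_neq0; lra.
have [le|gt] := leP `|a| `|c|.
  exists 1%N, ((2 * c * n + b) ^+ 2 - 4 * c * (c * n ^+ 2 + b * n + a)).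
  split; [exact: gauss_irrational|exact: gauss_itv|].
  exists c, (2 * c * n + b), (c * n ^+ 2 + b * n + a); split => //.
  by apply: (gauss_form_sign (x := x)) => //; right.
have cN : (`|c| <= N)%N by lia.
have [k [D kD]] := IH _ _ _ _ cN (gauss_irrational irr) (gauss_itv irr)
  (root_of_neq0 irr rx a0) rg.
by exists k.+1, D; rewrite iterSr.
Qed.

(** Two distinct positive roots would have the positive product [c/a] by Vieta. *)
Lemma root_of_unique a b c x y : a * c < 0 -> 0 < x -> 0 < y ->
  root_of a b c x -> root_of a b c y -> x = y.
Proof.
rewrite -(ltrz0 R) rmorphM /root_of /=.
move: a%:~R b%:~R c%:~R => A B C AC x0 y0 rx ry.
apply/eqP; rewrite -subr_eq0; apply: contraLR AC => xy; rewrite -leNgt.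
have e : A * (x + y) + B = 0.
  apply: (mulfI xy); rewrite mulr0 -[RHS](subr0 0) -{1}rx -ry; ring.
have -> : C = A * x * y.
  have -> : C = (A * x ^+ 2 + B * x + C) - x * (A * (x + y) + B) + A * x * y by ring.
  by rewrite rx e mulr0 subr0 add0r.
have -> : A * (A * x * y) = A ^+ 2 * (x * y) by ring.
by rewrite mulr_ge0 ?sqr_ge0 // ltW // mulr_gt0.
Qed.

(** Pigeonhole: [D = b^2 + 4 |a| |c|] bounds the coefficients of the forms of all iterates by [|D|],
    so two iterates share a form, and the form determines its positive root. *)
Lemma reduced_periodic D x : reduced D x ->
  exists i p, iter p.+1 gauss (iter i gauss x) = iter i gauss x.
Proof.
move=> rx.
have rk k : reduced D (iter k gauss x).
  by elim: k => //= k; exact: reduced_gauss.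
have /choice[t Ht] : forall k, exists t : int * int * int,
    [/\ root_of t.1.1 t.1.2 t.2 (iter k gauss x), t.1.1 * t.2 < 0 &
        t.1.2 ^+ 2 - 4 * t.1.1 * t.2 = D].
  by move=> k; have [_ _ [a [b [c abc]]]] := rk k; exists (a, b, c).
pose N := `|D|%N.
(* The shift by [N] maps [[-N, N]] into [0, ..., 2 N], where [inord] does not fall back on its
   default value. *)
pose enc (a : int) : 'I_(2 * N).+1 := inord (absz (a + N%:Z)).
have enc_inj a b : `|a| <= N%:Z -> `|b| <= N%:Z -> enc a = enc b -> a = b.
  move=> aN bN /(congr1 val) /=; rewrite !inordK; lia.
have bound k : [/\ `|(t k).1.1| <= N%:Z, `|(t k).1.2| <= N%:Z & `|(t k).2| <= N%:Z].
  have [_ ac HD] := Ht k; move: ac HD; rewrite /N.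
  move: (t k) => [[a b] c] /=; rewrite expr2 => ac HD.
  have nac : `|a| * `|c| = - (a * c) by rewrite -normrM ltr0_norm.
  have a1 : 1 <= `|a| 
    by apply: contraTT ac => ?; have -> : a = 0; [lia|rewrite mul0r].
  have c1 : 1 <= `|c|.
    by apply: contraTT ac => ?; have -> : c = 0; [lia|rewrite mulr0].
  have leac : `|a| <= `|a| * `|c| by rewrite ler_peMr.
  have leca : `|c| <= `|a| * `|c| by rewrite ler_peMl.
  have b2 : `|b| <= b * b by nia.
  have -> : `|D|%N%:Z = D by rewrite gez0_abs; lia.
  by split; lia.
pose f k := (enc (t k).1.1, enc (t k).1.2, enc (t k).2).
have f_inj i j : f i = f j -> iter i gauss x = iter j gauss x.
  move=> [e1 e2 e3].
  have [ai bi ci] := bound i; have [aj bj cj] := bound j.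
  have {e1}e1 := enc_inj _ _ ai aj e1.
  have {e2}e2 := enc_inj _ _ bi bj e2.
  have {e3}e3 := enc_inj _ _ ci cj e3.
  have [ri aci _] := Ht i; have [rj _ _] := Ht j.
  have [_ /andP[i0 _] _] := rk i; have [_ /andP[j0 _] _] := rk j.
  by apply: root_of_unique aci i0 j0 ri _; rewrite e1 e2 e3.
have [i [j [ij eij]]] : exists i j, (i < j)%N /\ f i = f j.
  pose T := ('I_(2 * N).+1 * 'I_(2 * N).+1 * 'I_(2 * N).+1)%type.
  pose g (k : 'I_(#|{: T}|.+1)) : T := f k.
  have : ~~ injectiveb g.
    apply/negP => /injectiveP /leq_card; by rewrite card_ord ltnn.
  case/injectivePn => i [j ij gij].
  have [lt|lt|/val_inj e] := ltngtP i j.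
  - by exists i, j.
  - by exists j, i.
  - by rewrite e eqxx in ij.
exists i, (j - i).-1; rewrite prednK ?subn_gt0 // -iterD subnK 1?ltnW //.
by apply/esym/f_inj.
Qed.

End QuadraticIrrationals.
Arguments gauss {R} x.

(** * The recursion along Gauss orbits and rational values at quadratic irrationals *)

Section GaussRecursion.
Variables (R : realType) (J : R -> R).
Hypothesis Jlow : forall x : R, 0 < x <= 2^-1 ->
  J x = 4 ^ (- Num.floor x^-1) * (1 - 2 * J (gauss x)).
Hypothesis Jhigh : forall x : R, 2^-1 <= x <= 1 ->
  J x = 3 / 8 - 3 / 4 * J (x^-1 - 1) - 2^-1 * J (1 - x).

Lemma gauss_low_affine (x : R) : 0 < x <= 2^-1 ->
  exists2 g : rat, 0 <= g <= 16^-1 & J x = ratr g * (1 - 2 * J (gauss x)).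
Proof.
move=> x0; rewrite Jlow //.
have xi : 2 <= x^-1 by rewrite -[2]invrK lef_pV2 ?posrE; lra.
have f2 : (2 <= Num.floor x^-1)%R by rewrite floor_ge_int.
case E: (Num.floor x^-1) f2 => [[|[|n]]|n] // _.
exists (4^-1 ^+ n.+2); last by rewrite rmorphXn fmorphV /= ratr_nat -invr_expz exprVn.
rewrite exprn_ge0 //= !exprS mulrA.
have -> : 4^-1 * 4^-1 = 16^-1 :> rat by [].
by rewrite ler_piMr // exprn_ile1.
Qed.

Lemma gauss_high (x : R) : 2^-1 < x < 1 -> gauss x = x^-1 - 1.
Proof.
move=> x1; rewrite /gauss (_ : Num.floor x^-1 = 1) //.
apply/floor_def; rewrite intrD.
have x2 : x^-1 < 2 by rewrite -[2]invrK ltf_pV2 ?posrE; lra.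
have : 1 <= x^-1 by rewrite invf_ge1; lra.
by lra.
Qed.

(** Since [1/(1 - x) = 1/(1/x - 1) + 1], the point [1 - x] rejoins the Gauss orbit of [x]. Hence the
    branching recursion follows a single orbit. *)
Lemma gauss_compl (x : R) : 2^-1 < x < 1 -> gauss (1 - x) = gauss (gauss x).
Proof.
move=> x1.
have g := gauss_high x1.
have -> : gauss (1 - x) = (gauss x)^-1 + 1%:~R - (Num.floor ((gauss x)^-1 + 1%:~R))%:~R.
  rewrite /gauss -/(gauss x) g.
  have -> : (1 - x)^-1 = (x^-1 - 1)^-1 + 1; last by [].
  by field; rewrite !(subr_eq0, lt0r_neq0) //; lra.
by rewrite floorDrz // [Num.floor 1%:~R]intrKfloor intrD /gauss; ring.
Qed.

(** The bound [13/16] is [3/4 + 1/16]: above one half, the term at [1 - x] is expanded once more by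
    the lower branch, whose coefficient [g] is at most [1/16]. Below one half the sum is
    [2 g <= 1/8]. *)
Lemma gauss_affine (x : R) : 0 < x < 1 -> x != 2^-1 ->
  exists b g a : rat, `|b| + `|g| <= 13 / 16 /\
    J x = ratr b * J (gauss x) + ratr g * J (gauss (gauss x)) + ratr a.
Proof.
move=> x01 xh; have [xl|xg] := leP x 2^-1.
  have [g g0 ->] := @gauss_low_affine x ltac:(lra).
  exists (- (2 * g)), 0, g; split.
    by rewrite normr0 normrN ger0_norm; lra.
  by rewrite rmorphN rmorphM rmorph0 /= ratr_nat; ring.
have [g g0 Hg] := @gauss_low_affine (1 - x) ltac:(lra).
exists (- (3 / 4)), g, (3 / 8 - g / 2); split.
  by rewrite normrN !ger0_norm; lra.
rewrite Jhigh; last by lra.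
rewrite Hg gauss_compl; last by lra.
rewrite -gauss_high; last by lra.
rewrite !(rmorphN, rmorphB, rmorphM) /= !fmorphV /= !ratr_nat; lra.
Qed.

Lemma gauss_affine_iter (x : R) : ~ is_rational x -> 0 < x < 1 -> forall m : nat,
  exists b g a : rat, `|b| + `|g| <= 13 / 16 /\
    J x = ratr b * J (iter m.+1 gauss x) + ratr g * J (iter m.+2 gauss x) + ratr a.
Proof.
have half (y : R) : ~ is_rational y -> y != 2^-1.
  by move=> irr; apply/eqP => e; apply: irr; exists 2^-1; rewrite e fmorphV /= ratr_nat.
move=> irr x01; elim=> [|m [b [g [a [bg ->]]]]].
  by apply: gauss_affine => //; exact: half.
have irr' : ~ is_rational (iter m.+1 gauss x).
  exact: iter_gauss_irrational.
have itv' : 0 < iter m.+1 gauss x < 1 by exact: iter_gauss_itv.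
have [b' [g' [a' [bg' ->]]]] := gauss_affine itv' (half _ irr').
(* Substituting for the first of the two values does not increase [`|b| + `|g|]. *)
exists (b * b' + g), (b * g'), (b * a' + a); split; last first.
  by rewrite !(rmorphD, rmorphM) /=; ring.
apply: le_trans bg; rewrite (le_trans (lerD (ler_normD _ _) (lexx _))) //.
rewrite !normrM addrAC lerD2r -mulrDr ler_piMr //; lra.
Qed.

Lemma gauss_rational_back (x : R) k : ~ is_rational x -> 0 < x < 1 ->
  is_rational (J (iter k gauss x)) -> is_rational (J (iter k.+1 gauss x)) ->
  is_rational (J x).
Proof.
case: k => [//|k] irr x01 r1 r2.
have [b [g [a [_ ->]]]] := gauss_affine_iter irr x01 k.
apply: is_rationalD; last by exists a.
by apply: is_rationalD; apply: is_rationalM => //; exact: is_rational_ratr.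
Qed.

Lemma gauss_periodic_rational (x : R) p : ~ is_rational x -> 0 < x < 1 ->
  iter p.+1 gauss x = x -> is_rational (J x).
Proof.
move=> irr x01 per.
(* The doubled period is at least [2], so [gauss x] still needs at least one step to reach [x], even
   if [x] is a fixed point. *)
have per2 : iter (p + p).+2 gauss x = x by rewrite -addnS -addSn iterD per.
have [b [g [a [bg e0]]]] := gauss_affine_iter irr x01 (p + p).+1.
have [b' [g' [a' [bg' e1]]]] :=
  gauss_affine_iter (gauss_irrational irr) (gauss_itv irr) (p + p).
move: e0 e1; rewrite -!iterSr [iter (p + p).+3 _ _]iterS per2.
set v0 := J x; set v1 := J (gauss x) => e0 e1.
(* Going once around the cycle from [x] and from [gauss x] gives a 2 by 2 linear system for [v0] and
   [v1]. Its rows are strictly diagonally dominant, so the determinant is positive, and the witness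
   below is Cramer's rule. *)
pose det : rat := (1 - b) * (1 - g') - g * b'.
have det0 : 0 < det.
  rewrite /det subr_gt0.
  have h1 : `|g| < 1 - b by have := ler_norm b; lra.
  have h2 : `|b'| < 1 - g' by have := ler_norm g'; lra.
  apply: le_lt_trans (ler_norm _) _; rewrite normrM.
  by apply: ltr_pM.
exists ((a * (1 - g') + g * a') / det).
have rdet : ratr det != 0 :> R by rewrite fmorph_eq0 lt0r_neq0.
apply: (mulIf rdet); rewrite -rmorphM divfK ?lt0r_neq0 // mulrC.
rewrite /det !(rmorphB, rmorphD, rmorphM) /= rmorph1.
have -> : ratr a = v0 - ratr b * v0 - ratr g * v1 by rewrite [X in X - _ - _]e0; ring.
have -> : ratr a' = v1 - ratr b' * v0 - ratr g' * v1.
  by rewrite [X in X - _ - _]e1; ring.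
by ring.
Qed.

Lemma gauss_quadratic_rational (x : R) : 0 < x < 1 -> quadratic_irrational x ->
  is_rational (J x).
Proof.
move=> x01 [irr [a [b [c [a0 rx]]]]].
have [k [D red]] : exists k D, reduced D (iter k gauss x).
  (* Clearing denominators gives an integral form. *)
  pose m := denq a * denq b * denq c.
  have m0 : m != 0 by rewrite !mulf_neq0 // denq_neq0.
  pose a' := numq a * denq b * denq c.
  pose b' := numq b * denq a * denq c.
  pose c' := numq c * denq a * denq b.
  apply: (@reach_reduced R a' b' c') => //.
    by rewrite !mulf_neq0 // ?denq_neq0 // numq_eq0.
  have num (q : rat) : (numq q)%:~R = ratr q * (denq q)%:~R :> R.
    by rewrite /ratr divfK // intr_eq0 denq_neq0.
  rewrite /root_of /a' /b' /c' !rmorphM /= !num.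
  rewrite -[RHS](mulr0 (m%:~R)) -[in RHS]rx /m !rmorphM /=.
  by ring.
have [i [p per]] := reduced_periodic red.
have irrk n := @iter_gauss_irrational R n x irr.
have itvk n := @iter_gauss_itv R n x irr x01.
rewrite -(iterD i k) in per.
(* The two consecutive values from which [J x] is recovered are taken at points of the cycle. *)
apply: (@gauss_rational_back x (i + k)) => //.
  exact: gauss_periodic_rational per.
apply: (@gauss_periodic_rational _ p) => //.
by rewrite -iterSr iterS per.
Qed.
End GaussRecursion.

Lemma quadratic_irrationalN (R : realType) (x : R) :
  quadratic_irrational x -> quadratic_irrational (- x).
Proof.
move=> [irr [a [b [c [a0 e]]]]]; split.
  by move=> /is_rationalN; rewrite opprK.
by exists a, (- b), c; split => //; rewrite rmorphN mulrNN sqrrN.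
Qed.

Lemma quadratic_irrationalD1 (R : realType) (x : R) :
  quadratic_irrational x -> quadratic_irrational (x + 1).
Proof.
move=> [irr [a [b [c [a0 e]]]]]; split.
  move=> r; apply: irr; rewrite -[x](addrK 1); apply: is_rationalD => //.
  exact: (is_rational_int _ (-1)).
exists a, (b - 2 * a), (c - b + a); split => //.
by rewrite -[RHS]e !(rmorphD, rmorphN, rmorphM, rmorph1) /=; ring.
Qed.

Lemma quadratic_irrationalV (R : realType) (x : R) :
  quadratic_irrational x -> quadratic_irrational x^-1.
Proof.
move=> [irr [a [b [c [a0 e]]]]].
have x0 : x != 0 by apply/eqP => x0; apply: irr; exists 0; rewrite x0 rmorph0.
split; first by move=> /is_rationalV; rewrite invrK.
exists c, b, a; split.
  apply/eqP => c0; apply: irr; exists (- b / a).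
  rewrite rmorphM rmorphN fmorphV /=.
  have ra : ratr a != 0 :> R by rewrite fmorph_eq0.
  apply: (mulfI ra); apply: (mulIf x0).
  rewrite mulrCA mulfV // mulr1 -[RHS]addr0 -e c0 rmorph0; ring.
apply: (mulIf (expf_neq0 2 x0)); rewrite mul0r -[RHS]e.
by field.
Qed.

(** * Folding maps *)

Section Folding.
Variable R : realType.
Implicit Types (z w : R * R) (u : seq 'I_3).

(* [o1], [o2], [o3] are the paper's indices 1, 2, 3; their values are 0, 1, 2. *)
Definition o1 : 'I_3 := Ordinal (isT : (0 < 3)%N).
Definition o2 : 'I_3 := Ordinal (isT : (1 < 3)%N).
Definition o3 : 'I_3 := Ordinal (isT : (2 < 3)%N).

Lemma ord3P (P : 'I_3 -> Prop) : P o1 -> P o2 -> P o3 -> forall i, P i.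
Proof.
move=> P1 P2 P3 [[|[|[|//]]] lt]; rewrite (bool_irrelevance lt isT); by [].
Qed.

(** The one-way reflection with the side of the base point resolved. It is defined on the whole
    plane, so it also acts on the real axis, where the limit lives. *)
Definition fold (i : 'I_3) z : R * R :=
  match val i with
  | 0%N => if - 2^-1 < z.1 then (-1 - z.1, z.2) else z
  | 1%N => if 1 < sq_norm z then (z.1 / sq_norm z, z.2 / sq_norm z) else z
  | _ => if z.1 < 0 then (- z.1, z.2) else z
  end.

Lemma tau_fold (z0 : R * R) : - 2^-1 < z0.1 < 0 -> 1 < sq_norm z0 ->
  tau z0 = fold.
Proof.
move=> z01 z0n; apply/funext => i; apply/funext => z.
have s1 : 0 < side o1 z0 by rewrite /side /=; lra.
have s2 : 0 < side o2 z0 by rewrite /side /=; lra.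
have s3 : side o3 z0 < 0 by rewrite /side /=; lra.
elim/ord3P: i; rewrite /tau /same_side.
- rewrite pmulr_lgt0 // /fold /refl /side /=.
  by have -> : (0 < z.1 + 2^-1) = (- 2^-1 < z.1); [apply/idP/idP; lra|].
- by rewrite pmulr_lgt0 // /fold /refl /side /= subr_gt0.
- by rewrite nmulr_lgt0 // /fold /refl /side.
Qed.

Definition rfold (i : 'I_3) (x : R) : R :=
  match val i with
  | 0%N => if - 2^-1 < x then -1 - x else x
  | 1%N => if 1 < x ^+ 2 then x^-1 else x
  | _ => if x < 0 then - x else x
  end.

Lemma fold_real i (x : R) : fold i (x, 0) = (rfold i x, 0).
Proof.
elim/ord3P: i; rewrite /fold /rfold /sq_norm /=; try by case: ifP.
rewrite expr0n addr0; case: ifP => // x1; rewrite mul0r; congr pair.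
have x0 : x != 0 by apply: contraTneq x1 => ->; rewrite expr0n ltr10.
by field.
Qed.

Definition fword u z := foldr fold z u.
Definition rword u x := foldr rfold x u.

Lemma fword_real u x : fword u (x, 0) = (rword u x, 0).
Proof. by elim: u => //= i u ->; exact: fold_real. Qed.

Definition d2 z w : R := (z.1 - w.1) ^+ 2 + (z.2 - w.2) ^+ 2.

Lemma d2_ge0 z w : 0 <= d2 z w.
Proof. by rewrite addr_ge0 // sqr_ge0. Qed.

Lemma d2C z w : d2 z w = d2 w z.
Proof. by rewrite /d2 -sqrrN opprB -[(z.2 - _) ^+ 2]sqrrN opprB. Qed.

Lemma d2_inversion z w : 0 < sq_norm z -> 0 < sq_norm w ->
  d2 (z.1 / sq_norm z, z.2 / sq_norm z) (w.1 / sq_norm w, w.2 / sq_norm w) =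
  d2 z w / (sq_norm z * sq_norm w).
Proof.
move=> z0 w0; rewrite /d2 /sq_norm /= in z0 w0 *.
by field; rewrite !lt0r_neq0.
Qed.

(** The loss of squared distance factors as [(1 - 1/|z|^2) (|z - w|^2 + 1 - |w|^2)], and both
    factors are nonnegative here. *)
Lemma d2_inversion_mixed z w : 1 < sq_norm z -> sq_norm w <= 1 ->
  d2 (z.1 / sq_norm z, z.2 / sq_norm z) w <= d2 z w.
Proof.
move=> z1 w1; rewrite -subr_ge0.
have z0 : sq_norm z != 0 by rewrite lt0r_neq0; lra.
have -> : d2 z w - d2 (z.1 / sq_norm z, z.2 / sq_norm z) w =
    (1 - (sq_norm z)^-1) * (d2 z w + 1 - sq_norm w).
  move: z0; rewrite /d2 /sq_norm /= => z0; field; exact: z0.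
have zi : (sq_norm z)^-1 < 1 by rewrite invf_lt1; lra.
apply: mulr_ge0; first by lra.
by have := d2_ge0 z w; lra.
Qed.

Lemma d2_fold i z w : d2 (fold i z) (fold i w) <= d2 z w.
Proof.
elim/ord3P: i; rewrite /fold /=.
- case: ifPn => hz; case: ifPn => hw; rewrite -?leNgt in hz hw *; rewrite /d2 /=;
    rewrite ?lerD2r; nra.
- case: ifPn => hz; case: ifPn => hw; rewrite -?leNgt in hz hw *.
  + rewrite d2_inversion; [|lra|lra].
    by rewrite ler_pdivrMr ?ler_peMr ?d2_ge0 //; nra.
  + exact: d2_inversion_mixed.
  + by rewrite d2C [leRHS]d2C; exact: d2_inversion_mixed.
  + by [].
- case: ifPn => hz; case: ifPn => hw; rewrite -?leNgt in hz hw *; rewrite /d2 /=;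
    rewrite ?lerD2r; nra.
Qed.

(** The constant concerns squared distances: a factor [4/9] on distances appears as [16/81]. *)
Definition contracts u (c : R) := forall z w, d2 (fword u z) (fword u w) <= c * d2 z w.

Lemma contracts1 u : contracts u 1.
Proof.
move=> z w; rewrite mul1r; elim: u => //= i u; apply: le_trans; exact: d2_fold.
Qed.

Lemma contracts_cat u u' c c' : 0 <= c ->
  contracts u c -> contracts u' c' -> contracts (u ++ u') (c * c').
Proof.
move=> c0 Hu Hu' z w; rewrite /fword !foldr_cat.
by apply: le_trans (Hu _ _) _; rewrite -mulrA ler_wpM2l //; exact: Hu'.
Qed.

Definition squeeze : seq 'I_3 := [:: o2; o1; o3; o1].

(** The letters act from right to left: the first three folds bring the real part below [-1/2],
    above [1/2] and below [-3/2] in turn. Both points then have squared norm at least [9/4], and the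
    inversion divides their squared distance by the product of the squared norms. *)
Lemma contracts_squeeze : contracts squeeze (16 / 81).
Proof.
move=> z w; rewrite /squeeze /fword /=.
have far (p : R * R) : 9 / 4 <= sq_norm (fold o1 (fold o3 (fold o1 p))).
  have : (fold o1 (fold o3 (fold o1 p))).1 <= - (3 / 2).
    rewrite /fold /=.
    by do ?[case: ifPn => /=]; rewrite -?leNgt; lra.
  by move: (fold o1 _) => q q1; rewrite /sq_norm; have := sqr_ge0 q.2; nra.
apply: (@le_trans _ _ (16 / 81 * d2 (fold o1 (fold o3 (fold o1 z)))
                                  (fold o1 (fold o3 (fold o1 w))))); last first.
  by rewrite ler_wpM2l //; have := contracts1 [:: o1; o3; o1] z w; rewrite mul1r.
move: (fold o1 (fold o3 (fold o1 z))) (fold o1 (fold o3 (fold o1 w)))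
  (far z) (far w) => {far}z' w' fz fw.
rewrite /fold /= !ifT; [|lra|lra].
rewrite d2_inversion; [|lra|lra].
rewrite mulrC ler_wpM2r ?d2_ge0 //.
have -> : 16 / 81 = (9 / 4 * (9 / 4))^-1 :> R by field.
rewrite lef_pV2 ?posrE; nra.
Qed.

Lemma fword_unit_disc u z : sq_norm (fword (o2 :: u) z) <= 1.
Proof.
rewrite /= /fold /=; case: ifPn => [h|]; last by rewrite leNgt.
move: h; move: (fword u z) => p h.
have -> : sq_norm (p.1 / sq_norm p, p.2 / sq_norm p) = (sq_norm p)^-1.
  have : sq_norm p != 0 by rewrite lt0r_neq0; lra.
  by rewrite /sq_norm /= => h'; field.
by rewrite invf_le1; lra.
Qed.

Lemma d2_unit_disc z w : sq_norm z <= 1 -> sq_norm w <= 1 -> d2 z w <= 4.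
Proof.
rewrite /sq_norm /d2 => hz hw.
have := sqr_ge0 (z.1 + w.1); have := sqr_ge0 (z.2 + w.2); lra.
Qed.

Lemma d2_coord_lt z w e : 0 < e -> d2 z w < e ^+ 2 ->
  `|z.1 - w.1| < e /\ `|z.2 - w.2| < e.
Proof.
rewrite /d2 => e0 lt; have h1 := sqr_ge0 (z.1 - w.1).
have h2 := sqr_ge0 (z.2 - w.2).
have key (x : R) : x ^+ 2 < e ^+ 2 -> `|x| < e.
  by rewrite -real_normK ?num_real // ltr_pXn2r // nnegrE // ltW.
by split; apply: key; lra.
Qed.

Lemma rword_lipschitz u x y : `|rword u x - rword u y| <= `|x - y|.
Proof.
have := contracts1 u (x, 0) (y, 0); rewrite mul1r !fword_real /d2 /=.
rewrite subrr expr0n !addr0 -[X in X <= _]real_normK ?num_real //.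
by rewrite -[X in _ <= X]real_normK ?num_real // ler_pXn2r // nnegrE.
Qed.

Lemma rfold_lipschitz i x y : `|rfold i x - rfold i y| <= `|x - y|.
Proof. exact: (rword_lipschitz [:: i]). Qed.

(** * Convergence along letter sequences that contain [squeeze] infinitely often *)

Section Trajectory.
Variable s : nat -> 'I_3.

Let pre m := [seq s k | k <- iota 0 m].

Definition squeezed_often :=
  forall n, exists2 m, (n <= m)%N & [seq s k | k <- iota m 4] = squeeze.

Hypothesis often : squeezed_often.

Lemma pre_cat m n : (m <= n)%N -> pre n = pre m ++ [seq s k | k <- iota m (n - m)].
Proof. by move=> mn; rewrite /pre -{1}(subnKC mn) iotaD map_cat. Qed.

Lemma often_contracts k : exists M, forall m, (M <= m)%N ->
  contracts (pre m) ((16 / 81) ^+ k).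
Proof.
elim: k => [|k [M HM]]; first by exists 0%N => m _; rewrite expr0; exact: contracts1.
have [m0 Mm0 em0] := often M.
exists (m0 + 4)%N => m mm.
rewrite (@pre_cat (m0 + 4) m) // -[X in contracts _ X]mulr1.
apply: contracts_cat; [by rewrite exprn_ge0| |exact: contracts1].
rewrite (@pre_cat m0) ?leq_addr // addKn em0 exprSr.
apply: contracts_cat; [by rewrite exprn_ge0|exact: HM|exact: contracts_squeeze].
Qed.

(** Let [squeeze] start at time [m0]. Every longer word is [pre m0] applied after a word beginning
    with [o2], whose values lie in the unit disc. This disc has squared diameter [4], so the
    contraction of [pre m0] gives a bound uniform in the starting points. *)
Lemma often_diam (e : R) : 0 < e -> exists n, forall m m' z w,
  (n < m)%N -> (n < m')%N -> d2 (fword (pre m) z) (fword (pre m') w) < e.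
Proof.
move=> e0.
have [k ke] : exists k, 4 * (16 / 81) ^+ k < e.
  have lt1 : `|16 / 81 : R| < 1 by rewrite ger0_norm; lra.
  have /cvgrPdist_lt /(_ (e / 4)) := cvg_expr lt1.
  case; first by lra.
  move=> k _ /(_ k (leqnn k)) /=; rewrite sub0r normrN ger0_norm ?exprn_ge0 //.
  by move=> lt; exists k; lra.
have [M HM] := often_contracts k.
have [m0 Mm0 em0] := often M.
exists m0 => m m' z w mm mm'.
have pre_disc n y : (m0 < n)%N -> exists2 y', sq_norm y' <= 1 &
    fword (pre n) y = fword (pre m0) y'.
  move=> mn; rewrite (pre_cat (ltnW mn)) /fword foldr_cat.
  eexists; last by [].
  have -> : (n - m0 = (n - m0).-1.+1)%N by lia.
  by move: em0 => /= [-> _ _ _]; exact: fword_unit_disc.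
have [z' z1 ->] := pre_disc m z mm.
have [w' w1 ->] := pre_disc m' w mm'.
apply: le_lt_trans (HM m0 Mm0 z' w') _; apply: le_lt_trans ke.
by rewrite mulrC ler_wpM2r ?exprn_ge0 // d2_unit_disc.
Qed.

Lemma often_cvg : cvgn (fun m => rword (pre m) 0).
Proof.
apply/cauchy_cvgP/cauchy_exP => e e0.
have e2 : 0 < e ^+ 2 by rewrite exprn_gt0.
have [n Hn] := often_diam e2.
exists (rword (pre n.+1) 0); exists n.+1 => //= m nm.
have := Hn n.+1 m (0, 0) (0, 0) (ltnSn n) nm.
by rewrite !fword_real => /(d2_coord_lt e0)[].
Qed.

Lemma often_cvg_fword z :
  (fun m => fword (pre m) z) @ \oo --> (limn (fun m => rword (pre m) 0), 0 : R).
Proof.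
have close e : 0 < e -> \forall m \near \oo,
    `|(fword (pre m) z).1 - rword (pre m) 0| < e /\ `|(fword (pre m) z).2| < e.
  move=> e0; have e2 : 0 < e ^+ 2 by rewrite exprn_gt0.
  have [n Hn] := often_diam e2.
  near=> m.
  have lt1 : (n < m)%N by near: m; exact: nbhs_infty_gt.
  have := Hn m m z (0, 0) lt1 lt1.
  by rewrite fword_real => /(d2_coord_lt e0) /= [? ]; rewrite subr0.
have -> : (fun m => fword (pre m) z) =
    (fun m => ((fword (pre m) z).1, (fword (pre m) z).2)).
  by apply/funext => m; rewrite -surjective_pairing.
have c1 : (fun m => (fword (pre m) z).1) @ \oo --> limn (fun m => rword (pre m) 0).
  have -> : (fun m => (fword (pre m) z).1) = (fun m => rword (pre m) 0 +
      ((fword (pre m) z).1 - rword (pre m) 0)).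
    by apply/funext => m; rewrite addrC subrK.
  rewrite -[X in _ --> X]addr0; apply: cvgD; first exact: often_cvg.
  apply/cvgrPdist_lt => e e0; near=> m; rewrite sub0r normrN.
  by near: m; apply: filterS (close e e0) => m [].
have c2 : (fun m => (fword (pre m) z).2) @ \oo --> (0 : R).
  apply/cvgrPdist_lt => e e0; near=> m; rewrite sub0r normrN.
  by near: m; apply: filterS (close e e0) => m [].
exact: (cvg_pair c1 c2).
Unshelve. all: by end_near. Qed.

End Trajectory.

(** The word is read off the subtractive Euclidean algorithm: [tau_1 tau_3] sends [-r] to [-(r + 1)]
    for [r >= 0], and [tau_2] inverts. This reaches the rationals [<= 0], and a final [tau_3] the
    positive ones. *)
Lemma rword_rational (q : rat) : exists u, rword u 0 = ratr q.
Proof.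
have neg N a b : (0 < b)%N -> (a + b <= N)%N -> exists u,
    rword u 0 = - (a%:R / b%:R).
  elim: N a b => [|N IH] a b b0 abN; first by lia.
  have [->|a0] := posnP a; first by exists [::]; rewrite mul0r oppr0.
  have ge1 a' b' u : (0 < b')%N -> (b' <= a')%N ->
      rword u 0 = - ((a' - b')%N%:R / b'%:R) ->
      rword [:: o1, o3 & u] 0 = - (a'%:R / b'%:R).
    move=> b'0 ab'; rewrite /= => -> ; rewrite natrB //.
    have b'p : 0 < b'%:R :> R by rewrite ltr0n.
    have -> : (a'%:R - b'%:R) / b'%:R = a'%:R / b'%:R - 1 :> R.
      by field; rewrite lt0r_neq0.
    have : 1 <= a'%:R / b'%:R :> R by rewrite ler_pdivlMr // mul1r ler_nat.
    move: (a'%:R / b'%:R) => r r1; rewrite /rfold /=.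
    by do ?[case: ifPn => /=]; rewrite -?leNgt; lra.
  have [ba|ab] := leqP b a.
    have [u Hu] := IH (a - b)%N b b0 ltac:(lia).
    by exists [:: o1, o3 & u]; exact: ge1.
  have [u Hu] := IH (b - a)%N a a0 ltac:(lia).
  exists [:: o2, o1, o3 & u]; move: (ge1 b a u a0 (ltnW ab) Hu) => /= ->.
  have ap : 0 < a%:R :> R by rewrite ltr0n.
  have bp : 0 < b%:R :> R by rewrite ltr0n.
  rewrite /rfold /= sqrrN ifT ?invrN ?invf_div //.
  by rewrite exprn_egt1 // ltr_pdivlMr // mul1r ltr_nat.
have [->|] := eqVneq q 0; first by exists [::]; rewrite rmorph0.
move=> q0.
have eq_q : `|q| = `|numq q|%N%:R / `|denq q|%N%:R.
  rewrite -{1}[q]divq_num_den normrM normfV -!intr_norm.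
  by rewrite 2!pmulrn !abszE.
have [u Hu] := neg _ `|numq q|%N `|denq q|%N
  ltac:(by rewrite absz_gt0 denq_neq0) (leqnn _).
have {}Hu : rword u 0 = - `|ratr q|.
  by rewrite Hu -ratr_norm eq_q rmorphM fmorphV /= !ratr_nat.
have [lt|ge] := ltP q 0.
  by exists u; rewrite Hu ltr0_norm ?ltrq0 // opprK.
exists (o3 :: u); rewrite /= Hu ger0_norm ?ler0q // /rfold /=.
case: ifPn => [_|]; first by rewrite opprK.
by rewrite oppr_lt0 ltr0q lt_neqAle eq_sym q0 ge.
Qed.

Definition to_zero (n : nat) : seq 'I_3 := o2 :: flatten (nseq n [:: o1; o3]).

(** Each round of [tau_1 tau_3] pushes the point one more unit to the left, and the last inversion
    brings it close to [0], wherever it started. *)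
Lemma to_zero_small n x : `|rword (to_zero n.+1) x| <= n.+1%:R^-1.
Proof.
(* The guard [0 < r] lets the first round start from an arbitrary point, because [tau_1 tau_3] maps
   the whole line into []-oo, -1]]. *)
have step y r : 0 <= r -> (0 < r -> y <= - r) -> rfold o1 (rfold o3 y) <= - (r + 1).
  move=> r0 yr; rewrite /rfold /=.
  have [r1|r1] := ltP 0 r.
    by move: (yr r1); do ?[case: ifPn => /=]; rewrite -?leNgt; lra.
  by do ?[case: ifPn => /=]; rewrite -?leNgt; lra.
have far k : (0 < k%:R :> R) -> rword (flatten (nseq k [:: o1; o3])) x <= - k%:R.
  elim: k => [|k IH _]; first by rewrite ltxx.
  by rewrite -natr1; exact: (step (rword (flatten (nseq k [:: o1; o3])) x)).
have {far} yn : rword (flatten (nseq n.+1 [:: o1; o3])) x <= - n.+1%:R by exact: far.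
rewrite /to_zero [rword (_ :: _) _](_ : _ =
  rfold o2 (rword (flatten (nseq n.+1 [:: o1; o3])) x)) //.
move: (rword _ x) yn => y yn.
have n1 : 1 <= n.+1%:R :> R by rewrite ler1n.
rewrite /rfold /=; case: ifPn => [y1|y1].
  rewrite normfV lef_pV2 ?posrE ?normr_gt0 ?ltr0n //; last by rewrite lt_eqF //; lra.
  by rewrite ler0_norm; lra.
(* The inversion leaves [y] in place only for [n = 0] and [y = -1]. *)
have y2 : y = -1.
  rewrite -leNgt in y1; nra.
by rewrite y2 normrN1 invf_ge1; rewrite y2 in yn; lra.
Qed.

End Folding.

(** * Uniform random words *)

Section RealProbability.
Context {R : realType} {d : measure_display} {T : measurableType d}.
Variable P : probability T R.
Implicit Types A B : set T.

Definition pr A : R := fine (P A).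

Lemma prK A : measurable A -> P A = (pr A)%:E.
Proof. by move=> mA; rewrite fineK // fin_num_measure. Qed.

Lemma pr_ge0 A : 0 <= pr A.
Proof. by rewrite fine_ge0. Qed.

Lemma le_pr A B : measurable A -> measurable B -> A `<=` B -> pr A <= pr B.
Proof.
move=> mA mB AB; rewrite -lee_fin -!prK //.
by apply: le_measure; rewrite ?inE.
Qed.

Lemma prU A B : measurable A -> measurable B -> A `&` B = set0 ->
  pr (A `|` B) = pr A + pr B.
Proof.
move=> mA mB AB; rewrite /pr measureU // fineD ?fin_num_measure //.
Qed.

Lemma prU_le A B : measurable A -> measurable B -> pr (A `|` B) <= pr A + pr B.
Proof.
move=> mA mB; rewrite -lee_fin EFinD -!prK //; last exact: measurableU.
exact: measureU2.
Qed.

Lemma prT : pr setT = 1.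
Proof. by rewrite /pr probability_setT. Qed.

Lemma pr0 : pr set0 = 0.
Proof. by rewrite /pr measure0. Qed.

Lemma prC A : measurable A -> pr (~` A) = 1 - pr A.
Proof.
move=> mA; apply/eqP; rewrite -subr_eq0 opprB addrA -prU //.
- by rewrite setvU prT subrr.
- exact: measurableC.
- exact: setICl.
Qed.

Lemma pr_decr_cvg (F : (set T)^nat) : (forall i, measurable (F i)) ->
  {homo F : n m / (n <= m)%N >-> m `<=` n} ->
  (pr \o F) @ \oo --> pr (\bigcap_n F n).
Proof.
move=> mF dF.
have mI : measurable (\bigcap_n F n) by exact: bigcapT_measurable.
have P0 : (P (F 0%N) < +oo)%E by rewrite prK // ltry.
have := @nonincreasing_cvg_mu _ _ _ P F P0 mF mI.
rewrite [X in _ --> X]prK // => /(_ _)/fine_cvg; apply => n m nm.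
by apply/subsetPset; exact: dF.
Qed.

Lemma pr_incr_cvg (F : (set T)^nat) : (forall i, measurable (F i)) ->
  {homo F : n m / (n <= m)%N >-> n `<=` m} ->
  (pr \o F) @ \oo --> pr (\bigcup_n F n).
Proof.
move=> mF dF.
have mI : measurable (\bigcup_n F n) by exact: bigcupT_measurable.
have := @nondecreasing_cvg_mu _ _ _ P F mF mI.
rewrite [X in _ --> X]prK // => /(_ _)/fine_cvg; apply => n m nm.
by apply/subsetPset; exact: dF.
Qed.
End RealProbability.

Section UniformWords.
Variable R : realType.
Implicit Types A B : seq 'I_3 -> bool.

(** The proportion of the words of length [m] that satisfy [A]. The recursion on the first letter is
    the splitting that stationarity uses. *)
Fixpoint wpr (m : nat) A : R :=
  if m is m'.+1 then 3^-1 * \sum_(i < 3) wpr m' (fun u => A (i :: u))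
  else (A [::])%:R.

Lemma wpr_false m : wpr m (fun=> false) = 0.
Proof. by elim: m => //= m ->; rewrite big1 ?mulr0. Qed.

Lemma wpr_split m A B :
  wpr m (fun u => ~~ B u && A u) = wpr m A - wpr m (fun u => B u && A u).
Proof.
elim: m A B => [|m IH] A B /=.
  by case: (A _); case: (B _); rewrite /= ?subr0 ?subrr.
by rewrite -mulrBr -sumrB; congr (_ * _); apply: eq_bigr => i _; rewrite IH.
Qed.

Lemma wpr_drop n m A : wpr (n + m) (fun u => A (drop n u)) = wpr m A.
Proof.
elim: n => [|n IH] /=.
  by congr wpr; apply/funext => u; rewrite drop0.
by under eq_bigr do rewrite IH; rewrite sumr_const card_ord; lra.
Qed.

Lemma wpr_prefix v m A :
  wpr (size v + m) (fun u => (take (size v) u == v) && A (drop (size v) u)) =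
  3^-1 ^+ size v * wpr m A.
Proof.
elim: v => [|x v IH] /=.
  rewrite expr0 mul1r; congr wpr; apply/funext => u.
  by rewrite take0 drop0 eqxx.
rewrite (bigD1 x) //= big1 ?addr0.
  rewrite exprS -mulrA -IH; congr (_ * wpr _ _); apply/funext => u.
  by rewrite eqseq_cons eqxx.
move=> i ix; rewrite -[RHS](wpr_false (size v + m)); congr wpr; apply/funext => u.
by rewrite eqseq_cons (negPf ix).
Qed.

(* Only the aligned blocks 0, ..., k - 1 of length [size v] are tested. *)
Fixpoint avoids (v : seq 'I_3) (k : nat) (u : seq 'I_3) : bool :=
  if k is k'.+1 then (take (size v) u != v) && avoids v k' (drop (size v) u) else true.

Lemma wpr_avoids v k : wpr (k * size v) (avoids v k) = (1 - 3^-1 ^+ size v) ^+ k.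
Proof.
elim: k => //= k IH; rewrite mulSn.
rewrite (wpr_split _ (fun u => avoids v k (drop (size v) u))
  (fun u => take (size v) u == v)).
by rewrite wpr_drop wpr_prefix IH exprS; ring.
Qed.
End UniformWords.

(** * The law of finite blocks of independent letters *)

Section IidLetters.
Context {R : realType} {d : measure_display} {T : measurableType d}.
Variables (P : probability T R) (X : nat -> T -> 'I_3).
Hypothesis iidX : iid_uniform3 P X.
Implicit Types A : seq 'I_3 -> bool.

Definition letters n m w := [seq X k w | k <- iota n m].

Lemma or3_ord (i : 'I_3) : [\/ i = o1, i = o2 | i = o3].
Proof. by elim/ord3P: i; [constructor 1|constructor 2|constructor 3]. Qed.

Lemma measurable_letter n i : measurable [set w | X n w = i].
Proof. exact: iidX.1. Qed.

Lemma measurable_letters n m A : measurable [set w | A (letters n m w)].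
Proof.
elim: m n A => [|m IH] n A.
  rewrite /letters /=; case: (A [::]).
    by rewrite (_ : mkset _ = setT) //; apply/seteqP.
  by rewrite (_ : mkset _ = set0) //; apply/seteqP; split.
pose E i := [set w | X n w = i] `&` [set w | A (i :: letters n.+1 m w)].
have mE i : measurable (E i).
  by apply: measurableI; [exact: measurable_letter|exact: (IH _ (fun u => A (i :: u)))].
have -> : [set w | A (letters n m.+1 w)] = E o1 `|` E o2 `|` E o3.
  apply/seteqP; split=> w; rewrite /E /=.
    move=> Aw; have [e|e|e] := or3_ord (X n w);
      by [left; left; rewrite -e|left; right; rewrite -e|right; rewrite -e].
  by move=> [[|]|] [<-].
by do 2?apply: measurableU.
Qed.

Lemma sum_ord3 (f : 'I_3 -> R) : \sum_(i < 3) f i = f o1 + f o2 + f o3.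
Proof.
rewrite !big_ord_recl big_ord0 addr0 addrA.
by congr (f _ + f _ + f _); apply: val_inj.
Qed.

Lemma pr_split_letter n (E : set T) : measurable E ->
  pr P E = \sum_(i < 3) pr P (E `&` [set w | X n w = i]).
Proof.
move=> mE; rewrite sum_ord3.
have mEX i : measurable (E `&` [set w | X n w = i]).
  by apply: measurableI => //; exact: measurable_letter.
have dis i j : i != j ->
    E `&` [set w | X n w = i] `&` (E `&` [set w | X n w = j]) = set0.
  by move=> /eqP ij; apply/seteqP; split=> w //= [[_ wi] [_ wj]]; apply: ij; rewrite -wi.
rewrite -prU //; last exact: dis.
rewrite -prU //; [|exact: measurableU|].
  congr (pr P _); apply/seteqP; split=> w /=; last by move=> [[|]|] [].
  by move=> Ew; have [e|e|e] := or3_ord (X n w); [left; left|left; right|right].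
by rewrite setIUl !dis // setU0.
Qed.

Lemma pr_cylinder n u : size u = n ->
  pr P [set w | letters 0 n w = u] = 3^-1 ^+ n.
Proof.
move=> su; have [_ [pX iX]] := iidX.
have -> : [set w | letters 0 n w = u] =
    \big[setI/setT]_(k <- iota 0 n) [set w | X k w = nth o1 u k].
  rewrite -bigcap_seq; apply/seteqP; split=> w /=.
    move=> <- k /=; rewrite mem_iota add0n => /andP[_ kn].
    by rewrite (nth_map 0%N) ?size_iota // nth_iota.
  move=> H; apply: (@eq_from_nth _ o1); first by rewrite size_map size_iota su.
  move=> k; rewrite size_map size_iota => kn.
  rewrite (nth_map 0%N) ?size_iota // nth_iota // add0n.
  by apply: H => /=; rewrite mem_iota.
rewrite /pr iX ?iota_uniq //=.
rewrite (eq_bigr (fun=> 3^-1)); last by move=> k _; rewrite pX.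
by rewrite big_const_seq count_predT size_iota iter_mulr mulr1.
Qed.

(** Independence of a prefix and the block after it. The induction on [m] splits on the next letter
    and appends it to the prefix, so that in the end only cylinders starting at time [0] are
    measured. *)
Lemma pr_cylinder_letters n m u A : size u = n ->
  pr P ([set w | letters 0 n w = u] `&` [set w | A (letters n m w)]) =
  3^-1 ^+ n * wpr R m A.
Proof.
have mcyl k v : measurable [set w | letters 0 k w = v].
  have := measurable_letters 0 k (fun u => u == v); congr measurable.
  by apply/seteqP; split=> w /= /eqP.
elim: m n u A => [|m IH] n u A su.
  rewrite /letters /=; case: (A [::]).
    rewrite (_ : mkset (fun=> is_true true) = setT); last by apply/seteqP.
    by rewrite setIT pr_cylinder ?mulr1.
  rewrite (_ : mkset (fun=> is_true false) = set0); last by apply/seteqP; split.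
  by rewrite setI0 pr0 mulr0.
rewrite (@pr_split_letter n); last first.
  by apply: measurableI; [exact: mcyl|exact: measurable_letters].
rewrite /= mulrA -exprSr mulr_sumr; apply: eq_bigr => i _.
rewrite -(IH n.+1 (rcons u i)) ?size_rcons ?su //; congr (pr P _).
have lS w : letters 0 n.+1 w = rcons (letters 0 n w) (X n w).
  by rewrite /letters -[n.+1]addn1 iotaD map_cat cats1.
apply/seteqP; split=> w /=; rewrite lS.
  by move=> [[-> Aw] <-].
move=> [/eqP]; rewrite eqseq_rcons => /andP[/eqP -> /eqP <-].
by [].
Qed.

Lemma pr_letters0 m A : pr P [set w | A (letters 0 m w)] = wpr R m A.
Proof.
rewrite -[RHS]mul1r -[1](expr0 3^-1) -(@pr_cylinder_letters 0 m [::]) //.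
by congr (pr P _); apply/seteqP; split=> w //= [].
Qed.

Lemma drop_letters n m w : drop n (letters 0 (n + m) w) = letters n m w.
Proof. by rewrite /letters iotaD map_cat drop_size_cat // size_map size_iota. Qed.

Lemma pr_letters n m A : pr P [set w | A (letters n m w)] = wpr R m A.
Proof.
rewrite -(wpr_drop _ n) -pr_letters0; congr (pr P _).
by apply/seteqP; split=> w /=; rewrite drop_letters.
Qed.

(** The letters at times [1, ..., m] are replaced by those at times [0, ..., m - 1], which have the
    same law. This yields stationarity without a shift on the probability space. *)
Lemma pr_letters0S m A : pr P [set w | A (letters 0 m.+1 w)] =
  3^-1 * \sum_(i < 3) pr P [set w | A (i :: letters 0 m w)].
Proof.
rewrite pr_letters0 /=; congr (_ * _); apply: eq_bigr => i _.
by rewrite (pr_letters0 m (fun u => A (i :: u))).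
Qed.

Lemma avoids_letters v k n w :
  (forall m, (n <= m)%N -> letters m (size v) w <> v) ->
  avoids v k (letters n (k * size v) w).
Proof.
elim: k n => [//|k IH] n H /=.
rewrite mulSn /letters iotaD map_cat.
rewrite take_size_cat ?drop_size_cat ?size_map ?size_iota //.
apply/andP; split; first exact/eqP/H.
by apply: IH => m nm; apply: H; apply: leq_trans nm; exact: leq_addr.
Qed.

(** The event [N n] that [squeeze] never starts at or after time [n] forces [k] disjoint blocks of
    four letters to differ from it, for every [k]. Its probability is thus at most
    [(1 - 3^-4)^k = (80/81)^k]. *)
Lemma squeezed_often_meas_ae :
  measurable [set w | squeezed_often (X^~ w)] /\
  P.-negligible (~` [set w | squeezed_often (X^~ w)]).
Proof.
pose B n m := [set w | letters m 4 w == squeeze] `&` [set _ | (n <= m)%N].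
have mB n m : measurable (B n m).
  apply: measurableI; first exact: (measurable_letters _ _ (fun u => u == squeeze)).
  by case: (n <= m)%N; [rewrite (_ : mkset _ = setT)|rewrite (_ : mkset _ = set0)] => //;
    apply/seteqP; split.
pose N n := ~` \bigcup_m B n m.
have mN n : measurable (N n) by apply: measurableC; exact: bigcupT_measurable.
have -> : [set w | squeezed_often (X^~ w)] = ~` \bigcup_n N n.
  apply/seteqP; split=> w /=.
    move=> H [n _]; apply; have [m nm e] := H n.
    by exists m => //; split=> //=; apply/eqP.
  move=> H n; apply: contrapT => Hn; apply: H; exists n => // -[m _ [/= /eqP e nm]].
  by apply: Hn; exists m.
split; first by apply: measurableC; exact: bigcupT_measurable.
rewrite setCK; apply: negligible_bigcup => n.
exists (N n); split => //.
have le k : pr P (N n) <= (80 / 81) ^+ k.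
  have -> : 80 / 81 = 1 - 3^-1 ^+ size squeeze :> R by rewrite /=; field.
  rewrite -wpr_avoids -(pr_letters n); apply: le_pr => //.
    exact: measurable_letters.
  move=> w /= Nw; apply: avoids_letters => m nm e; apply: Nw.
  by exists m => //; split=> //=; apply/eqP.
apply: (etrans (prK P (mN n))); congr EFin; apply/eqP; rewrite eq_le pr_ge0 andbT.
have lt1 : `|80 / 81 : R| < 1 by rewrite ger0_norm; lra.
apply/ler_addgt0Pr => e e0; rewrite add0r.
have /cvgrPdist_lt /(_ e e0)[k _ /(_ k (leqnn k))] := cvg_expr lt1.
rewrite /= sub0r normrN ger0_norm ?exprn_ge0 // => lt.
by apply: le_trans (le k) _; exact: ltW.
Qed.
End IidLetters.

(** * The limit point *)

Section LimitPoint.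
Context {R : realType} {d : measure_display} {T : measurableType d}.
Variables (P : probability T R) (X : nat -> T -> 'I_3).
Hypothesis iidX : iid_uniform3 P X.

Definition rwalk (m : nat) (w : T) : R := rword (letters X 0 m w) 0.

(** The default [0] off the almost sure event makes [zeta] an everywhere limit of measurable
    functions. *)
Definition zeta (w : T) : R :=
  if `[< squeezed_often (X^~ w) >] then limn (rwalk ^~ w) else 0.

Lemma measurable_rwalk m : measurable_fun setT (rwalk m).
Proof.
move=> _ Y mY; rewrite setTI.
have := measurable_letters iidX 0 m (fun u => `[< Y (rword u 0) >]).
by congr measurable; apply/seteqP; split=> w /= /asboolP.
Qed.

Lemma measurable_zeta : measurable_fun setT zeta.
Proof.
have [mG _] := squeezed_often_meas_ae iidX.
pose h m w := if `[< squeezed_often (X^~ w) >] then rwalk m w else 0.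
apply: (@measurable_fun_cvg _ _ _ _ h) => [m|w _]; last first.
  rewrite /h /zeta; case: ifPn => [/asboolP Gw|_]; last exact: cvg_cst.
  exact: (@often_cvg R (X^~ w)).
move=> _ Y mY; rewrite setTI.
have -> : h m @^-1` Y = ([set w | squeezed_often (X^~ w)] `&` rwalk m @^-1` Y)
    `|` (~` [set w | squeezed_often (X^~ w)] `&` [set _ | Y 0]).
  apply/seteqP; split=> w; rewrite /h /=.
    by case: ifPn => [/asboolP|/asboolPn] ? ?; [left|right].
  by move=> [[Gw Yw]|[Gw Y0]]; [rewrite asboolT|rewrite asboolF].
apply: measurableU; apply: measurableI => //.
- by rewrite -[_ @^-1` _]setTI; exact: measurable_rwalk.
- exact: measurableC.
- by have [Y0|Y0] := pselect (Y 0);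
    [rewrite (_ : mkset _ = setT)|rewrite (_ : mkset _ = set0)];
    rewrite //; apply/seteqP; split.
Qed.

Lemma rwalk_ae_cvg : {ae P, forall w, (rwalk ^~ w) @ \oo --> zeta w}.
Proof.
have [_ nG] := squeezed_often_meas_ae iidX.
apply: negligibleS nG => w /= H Gw; apply: H.
rewrite /zeta asboolT //; exact: (@often_cvg R (X^~ w)).
Qed.

(** Egorov's theorem: off a set of small probability, events about [zeta] can be compared with
    events about the walk at one finite time. *)
Lemma rwalk_uniform (e dlt : R) : 0 < e -> 0 < dlt ->
  exists B, [/\ measurable B, pr P B < dlt & exists m0, forall m w,
    (m0 <= m)%N -> ~ B w -> `|zeta w - rwalk m w| < e].
Proof.
move=> e0 d0.
have PT : (P setT < +oo)%E by rewrite probability_setT ltry.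
have ae : {ae P, forall w, [set: T] w -> (rwalk ^~ w) @ \oo --> zeta w}.
  by apply: filterS rwalk_ae_cvg => w H _.
have [B [mB PB uB]] := ae_pointwise_almost_uniform measurable_rwalk
  measurable_zeta measurableT PT ae d0.
exists B; split => //; first by rewrite -lte_fin -prK.
have nb : nbhs (zeta : {uniform` (setT `\` B) -> R})
    [set h : {uniform` (setT `\` B) -> R} |
      forall w, (setT `\` B) w -> ball (zeta w) e (h w)].
  apply/uniform_nbhs; exists [set xy : R * R | ball xy.1 e xy.2]; split => //.
  by rewrite -entourage_ballE; exists e.
have [m0 _ Hm0] := uB _ nb.
by exists m0 => m w mm Bw; apply: (Hm0 m mm w).
Qed.

Definition lip1 (g : R -> R) := forall x y, `|g x - g y| <= `|x - y|.

Lemma lip1_measurable g : lip1 g -> measurable_fun setT g.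
Proof.
move=> lg; apply: continuous_measurable_fun => x.
apply/cvgrPdist_lt => e e0; near=> y; apply: le_lt_trans (lg _ _) _.
by near: y; exact: cvgr_dist_lt.
Unshelve. all: by end_near. Qed.

Lemma measurable_le (f : T -> R) (c : R) : measurable_fun setT f ->
  measurable [set w | f w <= c].
Proof.
move=> mf; have := mf measurableT `]-oo, c]%classic (measurable_itv _).
by rewrite setTI; congr measurable; apply/seteqP; split=> w; rewrite /= in_itv.
Qed.

Lemma measurable_lip1_zeta g c : lip1 g -> measurable [set w | g (zeta w) <= c].
Proof.
move=> lg; apply: (measurable_le (f := g \o zeta)).
by apply: measurableT_comp; [exact: lip1_measurable|exact: measurable_zeta].
Qed.

Lemma measurable_lip1_rwalk g c m : lip1 g -> measurable [set w | g (rwalk m w) <= c].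
Proof.
move=> lg; apply: (measurable_le (f := g \o rwalk m)).
by apply: measurableT_comp; [exact: lip1_measurable|exact: measurable_rwalk].
Qed.

Lemma pr_le_cvg (f : T -> R) (c : R) : measurable_fun setT f ->
  (fun n => pr P [set w | f w <= c + n.+1%:R^-1]) @ \oo --> pr P [set w | f w <= c].
Proof.
move=> mf.
have -> : [set w | f w <= c] = \bigcap_n [set w | f w <= c + n.+1%:R^-1].
  apply/seteqP; split=> w /=.
    by move=> H n _ /=; apply: le_trans H _; rewrite lerDl invr_ge0.
  move=> H; apply/ler_addgt0Pr => e e0.
  have [n _ /(_ n (leqnn n))] := near_infty_natSinv_lt (PosNum e0).
  by move=> /= ne; apply: le_trans (H n I) _; rewrite lerD2l ltW.
apply: pr_decr_cvg => [n|n m nm w /=]; first exact: measurable_le.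
move/le_trans; apply; rewrite lerD2l lef_pV2 ?posrE //.
by rewrite ler_nat.
Qed.

Lemma pr_le_near (f : T -> R) (c eta : R) : measurable_fun setT f -> 0 < eta ->
  exists2 e, 0 < e & pr P [set w | f w <= c + e] < pr P [set w | f w <= c] + eta.
Proof.
move=> mf eta0.
have /cvgrPdist_lt /(_ _ eta0)[n _ /(_ n (leqnn n))] := pr_le_cvg (c := c) mf.
move=> /= H; exists n.+1%:R^-1; first by rewrite invr_gt0.
by move: H; rewrite ltr_distlC => /andP[].
Qed.

Lemma lip1_rfold g i : lip1 g -> lip1 (g \o rfold i).
Proof. by move=> lg x y; apply: le_trans (lg _ _) _; exact: rfold_lipschitz. Qed.

(** For the walk the identity is exact between times [m + 1] and [m]. In the limit the threshold [0]
    moves slightly, which right continuity of [c |-> P(g(zeta) <= c)] absorbs. Events of this form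
    cover half-lines, by [g y = y - x], and points, by [g y = |y - x|]. *)
Lemma zeta_stationary g : lip1 g ->
  3 * pr P [set w | g (zeta w) <= 0] =
  \sum_(i < 3) pr P [set w | g (rfold i (zeta w)) <= 0].
Proof.
move=> lg.
have step m c : pr P [set w | g (rwalk m.+1 w) <= c] =
    3^-1 * \sum_(i < 3) pr P [set w | g (rfold i (rwalk m w)) <= c].
  exact: (pr_letters0S iidX m (fun u => g (rword u 0) <= c)).
have approx (h : R -> R) B e m : lip1 h -> measurable B ->
    (forall w, ~ B w -> `|zeta w - rwalk m w| < e) -> forall c,
    pr P [set w | h (zeta w) <= c] <= pr P [set w | h (rwalk m w) <= c + e] + pr P B /\
    pr P [set w | h (rwalk m w) <= c] <= pr P [set w | h (zeta w) <= c + e] + pr P B.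
  move=> lh mB H c.
  have key w : ~ B w -> `|h (zeta w) - h (rwalk m w)| < e.
    by move=> Bw; apply: le_lt_trans (lh _ _) (H w Bw).
  split; apply: le_trans (prU_le P _ mB);
    do ?[exact: measurable_lip1_zeta|exact: measurable_lip1_rwalk];
    (apply: le_pr; [| |move=> w /= hc; have [Bw|Bw] := pselect (B w); [by right|left]]);
    do ?apply: measurableU;
    do ?[exact: measurable_lip1_zeta|exact: measurable_lip1_rwalk] => //;
    have := key w Bw; rewrite ltr_norml => /andP[]; lra.
have mz (h : R -> R) : lip1 h -> measurable_fun setT (h \o zeta).
  by move=> lh; apply: measurableT_comp; [exact: lip1_measurable|exact: measurable_zeta].
rewrite sum_ord3; apply/eqP; rewrite eq_le; apply/andP; split;
    apply/ler_addgt0Pr => eta eta0.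
  have near i := pr_le_near 0 (mz _ (lip1_rfold i lg)) (ltac:(lra) : 0 < eta / 9).
  have [e1 e10 H1] := near o1; have [e2 e20 H2] := near o2; have [e3 e30 H3] := near o3.
  (* The threshold moves by [e] twice, from [zeta] to the walk at time [m0 + 1] and from the walk at
     time [m0] back to [zeta]; hence the half. *)
  pose e := Num.min e1 (Num.min e2 e3) / 2.
  have e0 : 0 < e by rewrite divr_gt0 // !lt_min e10 e20.
  have [ee1 ee2 ee3] : [/\ e + e <= e1, e + e <= e2 & e + e <= e3].
    by rewrite /e -splitr !ge_min !lexx !orbT.
  have [B [mB pB [m0 Hm]]] := rwalk_uniform e0 (ltac:(lra) : 0 < eta / 18).
  have [a1 _] := approx g B e m0.+1 lg mB (fun w => Hm m0.+1 w (leqnSn _)) 0.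
  move: a1; rewrite step sum_ord3 add0r => a1.
  have b i := (approx _ B e m0 (lip1_rfold i lg) mB (fun w => Hm m0 w (leqnn _)) e).2.
  have mono i e' : e + e <= e' -> pr P [set w | (g \o rfold i) (zeta w) <= e + e] <=
      pr P [set w | (g \o rfold i) (zeta w) <= 0 + e'].
    move=> ee'; apply: le_pr; do ?[apply: measurable_lip1_zeta; exact: lip1_rfold].
    by move=> w /=; lra.
  have b1 := b o1; have b2 := b o2; have b3 := b o3.
  have c1 := mono o1 _ ee1; have c2 := mono o2 _ ee2; have c3 := mono o3 _ ee3.
  rewrite /= in H1 H2 H3 b1 b2 b3 c1 c2 c3.
  lra.
have [e' e'0 H] := pr_le_near 0 (mz _ lg) (ltac:(lra) : 0 < eta / 9).
pose e := e' / 2; have e0 : 0 < e by rewrite /e; lra.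
have [B [mB pB [m0 Hm]]] := rwalk_uniform e0 (ltac:(lra) : 0 < eta / 18).
have [_ a1] := approx g B e m0.+1 lg mB (fun w => Hm m0.+1 w (leqnSn _)) e.
move: a1; rewrite step sum_ord3 => a1.
have b i := (approx _ B e m0 (lip1_rfold i lg) mB (fun w => Hm m0 w (leqnn _)) 0).1.
have b1 := b o1; have b2 := b o2; have b3 := b o3.
move: a1 H; rewrite /e -splitr /= !add0r => a1 H.
rewrite /= !add0r /e in b1 b2 b3.
lra.
Qed.

Lemma zeta_prefix u w : squeezed_often (X^~ w) -> letters X 0 (size u) w = u ->
  forall a b : R, (forall x, a <= rword u x <= b) -> a <= zeta w <= b.
Proof.
move=> Gw eu a b ab.
have cv : rwalk ^~ w @ \oo --> zeta w.
  by rewrite /zeta asboolT //; exact: (@often_cvg R (X^~ w)).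
have inside : \forall m \near \oo, a <= rwalk m w <= b.
  exists (size u) => //= m um.
  rewrite /rwalk /letters -(subnKC um) iotaD map_cat -/(letters _ _ _ _) eu.
  by rewrite /rword foldr_cat; exact: ab.
apply/andP; split.
  apply: (cvgr_to_ge cv); by apply: filterS inside => m /andP[].
apply: (cvgr_to_le cv); by apply: filterS inside => m /andP[].
Qed.

(** A word [u] takes [0] to a rational [q] in the interval. Followed by a long [to_zero], it takes
    the whole line close to [q], since [u] does not increase distances. The cylinder of the combined
    word has positive probability and confines [zeta]. *)
Lemma pr_zeta_itv (a b : R) : a < b -> 0 < pr P [set w | a < zeta w <= b].
Proof.
move=> ab.
have [q] := rat_in_itvoo ab; rewrite in_itv /= => aqb.
have [u uq] := rword_rational R q.
pose e := Num.min (ratr q - a) (b - ratr q).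
have e0 : 0 < e by rewrite lt_min !subr_gt0.
have [n _ /(_ n (leqnn n)) /= ne] := near_infty_natSinv_lt (PosNum e0).
pose v := u ++ to_zero n.+1.
have close (x : R) : ratr q - n.+1%:R^-1 <= rword v x <= ratr q + n.+1%:R^-1.
  rewrite -ler_distl -uq /v /rword foldr_cat -!/(rword _ _).
  apply: le_trans (rword_lipschitz _ _ _) _; rewrite subr0.
  exact: to_zero_small.
have [mG nG] := squeezed_often_meas_ae iidX.
have pG : pr P (~` [set w | squeezed_often (X^~ w)]) = 0.
  by rewrite /pr (measure_negligible _ nG) //; exact: measurableC.
have mcyl : measurable [set w | letters X 0 (size v) w = v].
  have := measurable_letters iidX 0 (size v) (fun u => u == v); congr measurable.
  by apply/seteqP; split=> w /= /eqP.
have mab : measurable [set w | a < zeta w <= b].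
  have := measurable_zeta measurableT (measurable_itv `]a, b]).
  by rewrite setTI; congr measurable; apply/seteqP; split=> w; rewrite /= in_itv.
have pv : 0 < pr P [set w | letters X 0 (size v) w = v].
  by rewrite (pr_cylinder iidX) // exprn_gt0 // invr_gt0.
apply: lt_le_trans pv _.
rewrite -[leRHS]addr0 -pG.
apply: le_trans (prU_le P mab (measurableC mG)).
apply: le_pr => //; first by apply: measurableU => //; exact: measurableC.
move=> w /= wv; have [Gw|Gw] := pselect (squeezed_often (X^~ w)); last by right.
left; move: ne; rewrite lt_min => /andP[n1 n2].
have /andP[z1 z2] := zeta_prefix Gw wv close.
apply/andP; split; [apply: lt_le_trans z1|apply: le_trans z2 _].
  by rewrite ltrBrDr -ltrBrDl.
by rewrite -lerBrDl ltW.
Qed.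
End LimitPoint.

(** * Absence of atoms and the distribution function *)

Section StationaryLaw.
Context {R : realType} {d : measure_display} {T : measurableType d}.
Variables (P : probability T R) (Z : T -> R).
Hypothesis mZ : measurable_fun setT Z.
Hypothesis stat : forall g : R -> R, lip1 g ->
  3 * pr P [set w | g (Z w) <= 0] = \sum_(i < 3) pr P [set w | g (rfold i (Z w)) <= 0].

Let F := cdf_of P Z.
Let p x := pr P [set w | Z w = x].

Lemma measurable_preimage (Y : set R) : measurable Y -> measurable [set w | Y (Z w)].
Proof. by move=> mY; have := mZ measurableT mY; rewrite setTI. Qed.

Lemma measurable_atom x : measurable [set w | Z w = x].
Proof. exact: (measurable_preimage (measurable_set1 x)). Qed.

Lemma measurable_rfold_preimage i (Y : set R) : measurable Y ->
  measurable [set w | Y (rfold i (Z w))].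
Proof.
move=> mY; have mr : measurable_fun setT (@rfold R i).
  by apply: lip1_measurable => x y; exact: rfold_lipschitz.
by have := mr measurableT _ mY; rewrite setTI => /measurable_preimage.
Qed.

Lemma atom_stationary x : 3 * p x = pr P [set w | rfold o1 (Z w) = x] +
  pr P [set w | rfold o2 (Z w) = x] + pr P [set w | rfold o3 (Z w) = x].
Proof.
have lg : lip1 (fun y : R => `|y - x|).
  move=> y z; apply: le_trans (ler_dist_dist _ _) _.
  by rewrite opprB addrA subrK.
have eqs (f : T -> R) : [set w | `|f w - x| <= 0] = [set w | f w = x].
  by apply/seteqP; split=> w /=; rewrite normr_le0 subr_eq0 => /eqP.
have := stat lg; rewrite sum_ord3 (eqs Z) => ->.
by rewrite !(eqs (fun w => rfold _ (Z w))).
Qed.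

Lemma cdf_stationary x : 3 * F x = pr P [set w | rfold o1 (Z w) <= x] +
  pr P [set w | rfold o2 (Z w) <= x] + pr P [set w | rfold o3 (Z w) <= x].
Proof.
have lg : lip1 (fun y : R => y - x).
  by move=> y z; rewrite opprB addrA subrK.
have eqs (f : T -> R) : [set w | f w - x <= 0] = [set w | f w <= x].
  by apply/seteqP; split=> w /=; rewrite subr_le0.
have := stat lg; rewrite sum_ord3 (eqs Z) => ->.
by rewrite !(eqs (fun w => rfold _ (Z w))).
Qed.

Lemma atom_rfold0 i x : (forall y, rfold i y <> x) ->
  pr P [set w | rfold i (Z w) = x] = 0.
Proof.
move=> H; rewrite (_ : mkset _ = set0) ?pr0 //.
by apply/seteqP; split=> w //= /H.
Qed.

Lemma atom_rfold1 i x a : (forall y, rfold i y = x -> y = a) ->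
  pr P [set w | rfold i (Z w) = x] <= p a.
Proof.
move=> H; apply: le_pr; last by move=> w /= /H.
  exact: (measurable_rfold_preimage _ (measurable_set1 x)).
exact: measurable_atom.
Qed.

Lemma atom_rfold2 i x a b : (forall y, rfold i y = x -> y = a \/ y = b) ->
  pr P [set w | rfold i (Z w) = x] <= p a + p b.
Proof.
move=> H; apply: le_trans (prU_le P (measurable_atom a) (measurable_atom b)).
apply: le_pr; last by move=> w /= /H.
  exact: (measurable_rfold_preimage _ (measurable_set1 x)).
by apply: measurableU; exact: measurable_atom.
Qed.

Lemma rfold1_eq (x y : R) : rfold o1 y = x -> x <= - 2^-1 /\ (y = x \/ y = -1 - x).
Proof.
rewrite /rfold /=; case: ifPn; rewrite -?leNgt => h e; split; lra.
Qed.

(** The last clause collects the points with [x^-1 = x], including [0] by the convention [0^-1 = 0];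
    there a single atom bounds the preimage. *)
Lemma rfold2_eq (x y : R) : rfold o2 y = x ->
  [/\ -1 <= x <= 1, y = x \/ y = x^-1 & (x = 0) \/ (x = 1) \/ (x = -1) -> y = x].
Proof.
rewrite /rfold /=; case: ifPn => [h e|]; last first.
  by rewrite -leNgt => h <-; split=> //; [nra|left].
have y0 : y != 0 by apply: contraTneq h => ->; rewrite expr0n ltr10.
have yx : y = x^-1 by rewrite -e invrK.
have xy : x * y = 1 by rewrite -e mulVf.
split; [nra|by right|].
move=> [x0|[x1|x1]]; rewrite yx ?x0 ?x1 ?invr0 ?invr1 ?invrN1 //.
Qed.

Lemma rfold3_eq (x y : R) : rfold o3 y = x -> 0 <= x /\ (y = x \/ y = - x).
Proof.
rewrite /rfold /=; case: ifPn; rewrite -?leNgt => h e; split; lra.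
Qed.

Lemma atom_ge0 x : 0 <= p x. Proof. exact: pr_ge0. Qed.

(** The points [0], [-1], [1] and [-1/2], where the ranges of the general estimates meet, are
    treated separately and in this order: each time stationarity gives [3 p <= 2 p] plus atoms that
    vanish by the previous cases. *)
Lemma atom_0 : p 0 = 0.
Proof.
have := atom_stationary 0.
rewrite (@atom_rfold0 o1); last by move=> y /rfold1_eq; lra.
have h2 : pr P [set w | rfold o2 (Z w) = 0] <= p 0.
  by apply: atom_rfold1 => y /rfold2_eq[_ _]; apply; left.
have h3 : pr P [set w | rfold o3 (Z w) = 0] <= p 0.
  by apply: atom_rfold1 => y /rfold3_eq; lra.
have := atom_ge0 0; lra.
Qed.

Lemma atom_N1 : p (-1) = 0.
Proof.
have := atom_stationary (-1).
have h1 : pr P [set w | rfold o1 (Z w) = -1] <= p (-1) + p 0.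
  by apply: atom_rfold2 => y /rfold1_eq; lra.
have h2 : pr P [set w | rfold o2 (Z w) = -1] <= p (-1).
  by apply: atom_rfold1 => y /rfold2_eq[_ _]; apply; right; right.
rewrite (@atom_rfold0 o3); last by move=> y /rfold3_eq; lra.
have := atom_ge0 (-1); have := atom_0; lra.
Qed.

Lemma atom_1 : p 1 = 0.
Proof.
have := atom_stationary 1.
rewrite (@atom_rfold0 o1); last by move=> y /rfold1_eq; lra.
have h2 : pr P [set w | rfold o2 (Z w) = 1] <= p 1.
  by apply: atom_rfold1 => y /rfold2_eq[_ _]; apply; right; left.
have h3 : pr P [set w | rfold o3 (Z w) = 1] <= p 1 + p (-1).
  by apply: atom_rfold2 => y /rfold3_eq; lra.
have := atom_ge0 1; have := atom_N1; lra.
Qed.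

Lemma atom_gt1 x : 1 < x -> p x <= p (- x) / 2.
Proof.
move=> x1; have := atom_stationary x.
rewrite (@atom_rfold0 o1); last by move=> y /rfold1_eq; lra.
rewrite (@atom_rfold0 o2); last by move=> y /rfold2_eq[]; lra.
have h3 : pr P [set w | rfold o3 (Z w) = x] <= p x + p (- x).
  by apply: atom_rfold2 => y /rfold3_eq[].
lra.
Qed.

Lemma atom_ltN1 x : x < -1 -> p x <= p (-1 - x) / 2.
Proof.
move=> x1; have := atom_stationary x.
have h1 : pr P [set w | rfold o1 (Z w) = x] <= p x + p (-1 - x).
  by apply: atom_rfold2 => y /rfold1_eq[].
rewrite (@atom_rfold0 o2); last by move=> y /rfold2_eq[]; lra.
rewrite (@atom_rfold0 o3); last by move=> y /rfold3_eq; lra.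
lra.
Qed.

Lemma atom_Nhalf : p (- 2^-1) = 0.
Proof.
have := atom_stationary (- 2^-1).
have h1 : pr P [set w | rfold o1 (Z w) = - 2^-1] <= p (- 2^-1).
  by apply: atom_rfold1 => y /rfold1_eq; lra.
have h2 : pr P [set w | rfold o2 (Z w) = - 2^-1] <= p (- 2^-1) + p (-2).
  by apply: atom_rfold2 => y /rfold2_eq[_]; rewrite invrN invrK.
rewrite (@atom_rfold0 o3); last by move=> y /rfold3_eq; lra.
have := @atom_ltN1 (-2) ltac:(lra).
have -> : -1 - -2 = 1 :> R by ring.
have := atom_ge0 (- 2^-1); have := atom_1; lra.
Qed.

Lemma atom_N1_Nhalf x : -1 < x < - 2^-1 -> p x <= p (-1 - x) + p x^-1.
Proof.
move=> x1; have := atom_stationary x.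
have h1 : pr P [set w | rfold o1 (Z w) = x] <= p x + p (-1 - x).
  by apply: atom_rfold2 => y /rfold1_eq[].
have h2 : pr P [set w | rfold o2 (Z w) = x] <= p x + p x^-1.
  by apply: atom_rfold2 => y /rfold2_eq[].
rewrite (@atom_rfold0 o3); last by move=> y /rfold3_eq; lra.
lra.
Qed.

Lemma atom_Nhalf_0 x : - 2^-1 < x < 0 -> p x <= p x^-1 / 2.
Proof.
move=> x1; have := atom_stationary x.
rewrite (@atom_rfold0 o1); last by move=> y /rfold1_eq; lra.
have h2 : pr P [set w | rfold o2 (Z w) = x] <= p x + p x^-1.
  by apply: atom_rfold2 => y /rfold2_eq[].
rewrite (@atom_rfold0 o3); last by move=> y /rfold3_eq; lra.
lra.
Qed.

Lemma atom_0_1 x : 0 < x < 1 -> p x <= p x^-1 + p (- x).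
Proof.
move=> x1; have := atom_stationary x.
rewrite (@atom_rfold0 o1); last by move=> y /rfold1_eq; lra.
have h2 : pr P [set w | rfold o2 (Z w) = x] <= p x + p x^-1.
  by apply: atom_rfold2 => y /rfold2_eq[].
have h3 : pr P [set w | rfold o3 (Z w) = x] <= p x + p (- x).
  by apply: atom_rfold2 => y /rfold3_eq[].
lra.
Qed.

(** A single use of stationarity gains nothing on []-1, -1/2[] and []0, 1[]; the gain comes from
    iterating to preimages further out. The worst case is [0 < x < 1], with
    [p(1/x) + p(-x) <= c/4 + 9c/16 = 13c/16], which is below [7c/8]. *)
Lemma atom_contract c : (forall x, p x <= c) -> forall x, p x <= 7 / 8 * c.
Proof.
move=> pc x; have c0 : 0 <= c := le_trans (atom_ge0 0) (pc 0).
have big y : 1 < y -> p y <= c / 4.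
  move=> y1; have := atom_gt1 y1; have := @atom_ltN1 (- y) ltac:(lra).
  have := pc (-1 - - y); lra.
have small y : y < -2 -> p y <= c / 8.
  move=> y1; have := @atom_ltN1 y ltac:(lra); have := @big (-1 - y) ltac:(lra); lra.
have mid y : y < -1 -> p y <= c / 2.
  by move=> y1; have := atom_ltN1 y1; have := pc (-1 - y); lra.
have invN (y : R) : - 2^-1 < y < 0 -> y^-1 < -2.
  move=> y0; have -> : -2 = (- 2^-1)^-1 :> R by rewrite invrN invrK.
  by rewrite ltf_nV2 ?negrE; lra.
have near0 y : - 2^-1 < y < 0 -> p y <= c / 16.
  by move=> y0; have := atom_Nhalf_0 y0; have := small _ (invN y y0); lra.
have invN1 (y : R) : -1 < y < 0 -> y^-1 < -1.
  by move=> y0; rewrite -[ltRHS]invrN1 ltf_nV2 ?negrE; lra.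
have neg y : -1 < y < 0 -> p y <= c / 2 + c / 16.
  move=> y0; have [yh|yh|->] := ltgtP y (- 2^-1).
  - have := @atom_N1_Nhalf y ltac:(lra); have := mid _ (invN1 y y0).
    have := @near0 (-1 - y) ltac:(lra); lra.
  - have := @near0 y ltac:(lra); lra.
  - rewrite atom_Nhalf; lra.
have [x1|x1|->] := ltgtP x (-1); [|
  |by rewrite atom_N1; lra].
  by have := mid _ x1; lra.
have [x2|x2|->] := ltgtP x 0; [| |by rewrite atom_0; lra].
  by have := @neg x ltac:(lra); lra.
have [x3|x3|->] := ltgtP x 1; [| |by rewrite atom_1; lra].
  have := @atom_0_1 x ltac:(lra); have := @neg (- x) ltac:(lra).
  have xi : 1 < x^-1 by rewrite invf_gt1; lra.
  have := big _ xi; lra.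
by have := big _ x3; lra.
Qed.

Lemma no_atom x : p x = 0.
Proof.
have le k : forall x, p x <= (7 / 8) ^+ k.
  elim: k => [|k IH] y; last by rewrite exprS; exact: atom_contract.
  rewrite expr0 -(prT P); apply: le_pr => //; exact: measurable_atom.
apply/eqP; rewrite eq_le atom_ge0 andbT.
have lt1 : `|7 / 8 : R| < 1 by rewrite ger0_norm; lra.
apply/ler_addgt0Pr => e e0; rewrite add0r.
have /cvgrPdist_lt /(_ e e0)[k _ /(_ k (leqnn k))] := cvg_expr lt1.
rewrite /= sub0r normrN ger0_norm ?exprn_ge0 // => lt.
by apply: le_trans (le k x) _; exact: ltW.
Qed.

Lemma measurable_cdf x : measurable [set w | Z w <= x].
Proof. exact: measurable_le. Qed.

Lemma pr_oc x y : x <= y -> pr P [set w | x < Z w <= y] = F y - F x.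
Proof.
move=> xy; have m : measurable [set w | x < Z w <= y].
  have := measurable_preimage (measurable_itv `]x, y]).
  by congr measurable; apply/seteqP; split=> w; rewrite /= in_itv.
apply/eqP; rewrite eq_sym subr_eq addrC; apply/eqP.
rewrite /F /cdf_of -![fine (P _)]/(pr P _) -prU //; [|exact: measurable_cdf|].
  by congr (pr P _); apply/seteqP; split=> w /=; case: (leP (Z w) x); lra.
by apply/seteqP; split=> w //=; lra.
Qed.

Lemma cdf_nondecreasing x y : x <= y -> F x <= F y.
Proof. by move=> xy; rewrite -subr_ge0 -pr_oc // pr_ge0. Qed.

(** From here on endpoints carry no mass, so intervals of all types have probability [F y - F x]. *)
Lemma pr_cc x y : x <= y -> pr P [set w | x <= Z w <= y] = F y - F x.
Proof.
move=> xy; have m : measurable [set w | x < Z w <= y].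
  have := measurable_preimage (measurable_itv `]x, y]).
  by congr measurable; apply/seteqP; split=> w; rewrite /= in_itv.
rewrite -pr_oc // -[RHS]addr0 -(no_atom x) -prU //.
- by congr (pr P _); apply/seteqP; split=> w /=; case: (ltgtP (Z w) x); lra.
- exact: measurable_atom.
- by apply/seteqP; split=> w //=; lra.
Qed.

Lemma pr_lt x : pr P [set w | Z w < x] = F x.
Proof.
have m : measurable [set w | Z w < x].
  have := measurable_preimage (measurable_itv `]-oo, x[).
  by congr measurable; apply/seteqP; split=> w; rewrite /= in_itv.
rewrite -[LHS]addr0 -(no_atom x) -prU //.
- by congr (pr P _); apply/seteqP; split=> w /=; case: (ltgtP (Z w) x); lra.
- exact: measurable_atom.
- by apply/seteqP; split=> w //=; lra.
Qed.

Lemma pr_oo x y : x <= y -> pr P [set w | x < Z w < y] = F y - F x.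
Proof.
move=> xy.
have m : measurable [set w | x < Z w < y].
  have := measurable_preimage (measurable_itv `]x, y[).
  by congr measurable; apply/seteqP; split=> w; rewrite /= in_itv.
have m' : measurable [set w | x < Z w <= y].
  have := measurable_preimage (measurable_itv `]x, y]).
  by congr measurable; apply/seteqP; split=> w; rewrite /= in_itv.
rewrite -pr_oc //; apply/eqP; rewrite eq_le; apply/andP; split.
  by apply: le_pr => // w /=; lra.
rewrite -[leRHS]addr0 -(no_atom y).
apply: le_trans (prU_le P m (measurable_atom y)); apply: le_pr => //.
  by apply: measurableU => //; exact: measurable_atom.
by move=> w /=; case: (ltgtP (Z w) y); [left; lra|lra|right].
Qed.

Lemma pr_outside x y : x <= y ->
  pr P [set w | Z w <= x \/ y <= Z w] = F x + 1 - F y.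
Proof.
move=> xy.
have m : measurable [set w | x < Z w < y].
  have := measurable_preimage (measurable_itv `]x, y[).
  by congr measurable; apply/seteqP; split=> w; rewrite /= in_itv.
have -> : [set w | Z w <= x \/ y <= Z w] = ~` [set w | x < Z w < y].
  apply/seteqP; split=> w /=; first by move=> H /andP[]; case: H; lra.
  move=> H; case: (leP (Z w) x) => h1; [by left|right].
  by rewrite leNgt; apply/negP => h2; apply: H; rewrite h1.
by rewrite prC // pr_oo //; lra.
Qed.

Lemma pr_rfold1 x : x <= - 2^-1 ->
  pr P [set w | rfold o1 (Z w) <= x] = F x + 1 - F (-1 - x).
Proof.
move=> x1; rewrite -pr_outside; last by lra.
congr (pr P _); apply/seteqP; split=> w /=; rewrite /rfold /=.
  by case: ifPn; rewrite -?leNgt => h1 h2; [right|left]; lra.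
by case: ifPn; rewrite -?leNgt => h1 h2; case: h2; lra.
Qed.

Lemma pr_rfold_full i x : (forall y, rfold i y <= x) ->
  pr P [set w | rfold i (Z w) <= x] = 1.
Proof.
move=> H; rewrite -(prT P); congr (pr P _).
by apply/seteqP; split=> w //= _; exact: H.
Qed.

Lemma pr_rfold_empty i x : (forall y, x < rfold i y) ->
  pr P [set w | rfold i (Z w) <= x] = 0.
Proof.
move=> H; rewrite -(pr0 P); congr (pr P _); apply/seteqP; split=> w //=.
by rewrite leNgt H.
Qed.

Lemma pr_rfold1_full x : - 2^-1 <= x -> pr P [set w | rfold o1 (Z w) <= x] = 1.
Proof.
move=> x1; apply: pr_rfold_full => y; rewrite /rfold /=.
by case: ifPn; rewrite -?leNgt; lra.
Qed.

Lemma rfold2_bound (y : R) : -1 <= rfold o2 y <= 1.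
Proof. by have [] := rfold2_eq (erefl (rfold o2 y)). Qed.

Lemma pr_rfold2_neg x : -1 <= x < 0 ->
  pr P [set w | rfold o2 (Z w) <= x] = F x - F x^-1.
Proof.
move=> x0; have xi : x^-1 <= -1 by rewrite -[leRHS]invrN1 lef_nV2 ?negrE; lra.
rewrite -pr_cc; last by lra.
congr (pr P _); apply/seteqP; split=> w /=; rewrite /rfold /=; move: (Z w) => y.
  case: ifPn => h1 h2; last by rewrite -leNgt in h1; nra.
  have y0 : y < 0 by rewrite -invr_lt0; lra.
  have y1 : y <= x by nra.
  by rewrite y1 andbT -[leRHS]invrK lef_nV2 ?negrE ?invr_lt0 //; lra.
case: ifPn => h1 h2; last by lra.
by rewrite -[leRHS]invrK lef_nV2 ?negrE ?invr_lt0; lra.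
Qed.

Lemma pr_rfold2_pos x : 0 < x <= 1 ->
  pr P [set w | rfold o2 (Z w) <= x] = F x + 1 - F x^-1.
Proof.
move=> x0; have xi : 1 <= x^-1 by rewrite invf_ge1; lra.
rewrite -pr_outside; last by lra.
congr (pr P _); apply/seteqP; split=> w /=; rewrite /rfold /=; move: (Z w) => y.
  case: ifPn => h1 h2; last by left.
  have [y0|y0] := leP y 0; first by left; lra.
  by right; rewrite -[leRHS]invrK lef_pV2 ?posrE ?invr_gt0; lra.
have xx : x * x^-1 = 1 by rewrite divff // gt_eqF; lra.
case: ifPn => h1 h2; last first.
  rewrite -leNgt in h1; case: h2 => // h2.
  have y1 : y <= 1 by nra.
  by apply: le_trans y1 _; nra.
have [y0|y0] := ltP 0 y.
  rewrite -[leRHS]invrK lef_pV2 ?posrE ?invr_gt0 //; last by lra.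
  by case: h2 => // h2; nra.
have : y^-1 <= 0 by rewrite invr_le0.
lra.
Qed.

Lemma pr_rfold2_0 : pr P [set w | rfold o2 (Z w) <= 0] = F 0.
Proof.
congr (pr P _); apply/seteqP; split=> w /=; rewrite /rfold /=; move: (Z w) => y;
  by case: ifP; rewrite ?invr_le0.
Qed.

Lemma pr_rfold3 x : 0 <= x -> pr P [set w | rfold o3 (Z w) <= x] = F x - F (- x).
Proof.
move=> x0; rewrite -pr_cc; last by lra.
congr (pr P _); apply/seteqP; split=> w /=; rewrite /rfold /=; move: (Z w) => y;
  by case: ifPn; rewrite -?leNgt; lra.
Qed.

Lemma pr_rfold3_neg x : x < 0 -> pr P [set w | rfold o3 (Z w) <= x] = 0.
Proof.
move=> x0; apply: pr_rfold_empty => y; rewrite /rfold /=.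
by case: ifPn; rewrite -?leNgt; lra.
Qed.

Lemma cdf_fold_equations : fold_equations F.
Proof.
split.
- have := cdf_stationary 0.
  rewrite pr_rfold1_full ?pr_rfold2_0 ?pr_rfold3 ?oppr0; lra.
- move=> x x1; have := cdf_stationary x.
  rewrite pr_rfold1 ?pr_rfold3_neg; [|lra|lra].
  (* The image of [tau_2] contains [-1], so this endpoint is computed apart; its event has
     probability [F(-1) - F(-1) = 0]. *)
  have [x2|x2] := ltP x (-1); last first.
    have -> : x = -1 by lra.
    by rewrite pr_rfold2_neg ?invrN1; lra.
  by rewrite pr_rfold_empty => [|y]; [lra|have := rfold2_bound y; lra].
- move=> x x1; have := cdf_stationary x.
  by rewrite pr_rfold1 ?pr_rfold2_neg ?pr_rfold3_neg; lra.
- move=> x x1; have := cdf_stationary x.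
  by rewrite pr_rfold1_full ?pr_rfold2_neg ?pr_rfold3_neg; lra.
- move=> x x1; have := cdf_stationary x.
  by rewrite pr_rfold1_full ?pr_rfold2_pos ?pr_rfold3; lra.
- move=> x x1; have := cdf_stationary x.
  rewrite pr_rfold1_full ?pr_rfold3; [|lra|lra].
  by rewrite pr_rfold_full => [|y]; [lra|have := rfold2_bound y; lra].
Qed.

(** Right continuity holds for every law; left continuity comes from [pr_lt], that is, from the
    absence of atoms. *)
Lemma cdf_continuous : continuous F.
Proof.
move=> x; apply/cvgrPdist_lt => e e0.
have [e1 e10 H1] := pr_le_near P x mZ e0.
have [e2 e20 H2] : exists2 e2, 0 < e2 & F x - e < F (x - e2).
  pose G n := [set w | Z w <= x - n.+1%:R^-1].
  have cG : (pr P \o G) @ \oo --> F x.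
    have -> : F x = pr P (\bigcup_n G n).
      rewrite -pr_lt; congr (pr P _); apply/seteqP; split=> w /=.
        move=> lt; have lt' : 0 < x - Z w by rewrite subr_gt0.
        have [n _ /(_ n (leqnn n)) /= ne] := near_infty_natSinv_lt (PosNum lt').
        by exists n => //; rewrite /G /= lerBrDr -lerBrDl ltW.
      move=> [n _]; rewrite /G /= => /le_lt_trans; apply.
      by rewrite ltrBlDr ltrDl invr_gt0.
    apply: pr_incr_cvg => [n|n m nm w /=]; first exact: measurable_cdf.
    move/le_trans; apply; rewrite lerD2l lerN2 lef_pV2 ?posrE //.
    by rewrite ler_nat.
  have /cvgrPdist_lt /(_ e e0)[n _ /(_ n (leqnn n))] := cG.
  rewrite /= ltr_distlC => /andP[H _]; exists n.+1%:R^-1 => //.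
have d0 : 0 < Num.min e1 e2 by rewrite lt_min e10.
near=> y.
have : `|x - y| < Num.min e1 e2 by near: y; exact: cvgr_dist_lt.
rewrite lt_min !ltr_distlC => /andP[/andP[y1 y2] /andP[y3 y4]].
have m1 := @cdf_nondecreasing y (x + e1) ltac:(lra).
have m2 := @cdf_nondecreasing (x - e2) y ltac:(lra).
have H1' : F (x + e1) < F x + e := H1.
by lra.
Unshelve. all: by end_near. Qed.
End StationaryLaw.

(** The functional equations of [F] give the recursion at every real point of []0, 1]], hence along
    irrational Gauss orbits, whereas [interrobang_spec] states it at rationals only. *)
Lemma interrobang_quadratic_rational (R : realType) (F : R -> R) :
  fold_equations F -> forall x, quadratic_irrational x -> is_rational (F x).
Proof.
move=> HF.
apply: (cdf_formula_closed (D := quadratic_irrational) (S := is_rational)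
  (cdf_formula_fold HF)).
- exact: quadratic_irrationalN.
- exact: quadratic_irrationalD1.
- exact: quadratic_irrationalV.
- exact: (is_rational_int R 1).
- by exists 2^-1; rewrite fmorphV /= ratr_nat.
- exact: is_rationalD.
- exact: is_rationalN.
- exact: is_rationalM.
- move=> x qx x01; apply: (@gauss_quadratic_rational R (fun x => F x - 2^-1)) => //.
  + exact: fold_gauss_low.
  + exact: fold_gauss_high.
  + have [irr _] := qx.
    have x0 : x != 0 by apply/eqP => e; apply: irr; exists 0; rewrite e rmorph0.
    have x1 : x != 1 by apply/eqP => e; apply: irr; exists 1; rewrite e rmorph1.
    by rewrite !lt_neqAle eq_sym x0 x1; lra.
Qed.

Theorem mainTheorem16 (R : realType) (d : measure_display) (T : measurableType d)
    (P : probability T R) (X : nat -> T -> 'I_3) (z0 : R * R) :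
  0 < z0.2 -> - 2^-1 < z0.1 < 0 -> 1 < sq_norm z0 ->
  iid_uniform3 P X ->
  exists zeta : T -> R,
    measurable_fun setT zeta /\
    {ae P, forall w, (fun m => walk z0 X m w) @ \oo --> (zeta w, 0)} /\
    (exists I : R -> R, interrobang_spec I) /\
    (forall I : R -> R, interrobang_spec I -> cdf_formula I (cdf_of P zeta)) /\
    continuous (cdf_of P zeta) /\
    {homo cdf_of P zeta : x y / x < y} /\
    (forall q : rat, is_dyadic (cdf_of P zeta (ratr q))) /\
    (forall x : R, quadratic_irrational x -> is_rational (cdf_of P zeta x)).
Proof.
move=> _ z01 z0n iidX.
have mz : measurable_fun setT (zeta X) := measurable_zeta iidX.
have stat := zeta_stationary iidX.
have cF := cdf_continuous mz stat.
have HF := cdf_fold_equations mz stat.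
have HI := interrobang_fold HF cF.
have HC := cdf_formula_fold HF.
exists (zeta X); split; first exact: mz.
split.
  have [_ nG] := squeezed_often_meas_ae iidX.
  apply: negligibleS nG => w /= H Gw; apply: H.
  rewrite /walk (tau_fold z01 z0n) /zeta asboolT //.
  exact: (@often_cvg_fword R (X^~ w) Gw z0).
(* The witness is [F - 1/2] itself; uniqueness on [[0, 1]] then carries the formula over to any
   other solution. *)
split; first by eexists; exact: HI.
split; first by move=> I spI; apply: cdf_formula_eq HC; exact: interrobang_unique.
split; first exact: cF.
split.
  move=> x y xy; rewrite -subr_gt0 -(pr_oc P mz (ltW xy)).
  exact: pr_zeta_itv.
split; first exact: cdf_formula_dyadic HI HC.
exact: interrobang_quadratic_rational.
Qed.
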